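(* Let $\mathcal{E}$ be a differentially connected scalar differential equation in two independent variables $x,y$, and let $\tau\colon\tilde{\mathcal{E}}\to\mathcal{E}$ be a one-dimensional (rank $1$) non-Abelian covering over $\mathcal{E}$, given in a fiber coordinate $w$ by the total derivatives $$\tilde D_x=D_x+X\frac{\partial}{\partial w},\qquad \tilde D_y=D_y+Y\frac{\partial}{\partial w},\qquad X,Y\in\mathcal{F}(\tilde{\mathcal{E}}).$$ If $\tau$ is irreducible, then the covering $\tau^{\mathbf I}\colon\tilde{\mathcal{E}}^{\mathbf I}\to\tilde{\mathcal{E}}$ given by $$\psi_x=\frac{\partial X}{\partial w}\,\psi,\qquad \psi_y=\frac{\partial Y}{\partial w}\,\psi$$ defines a nontrivial conservation law of $\tilde{\mathcal{E}}$ (and, consequently, a nonlocal conservation law of $\mathcal{E}$). That is, the horizontal form $$\omega=\frac{\partial X}{\partial w}\,dx+\frac{\partial Y}{\partial w}\,dy$$ on $\tilde{\mathcal{E}}$, which corresponds to $\tau^{\mathbf I}$ via $\bar\psi=\ln\psi$, is closed and represents a nonzero class in $H_h^1(\tilde{\mathcal{E}})$.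
   Context: Everything is smooth and real. Considerations are local: one works in coordinate charts, with locally trivialized bundles. **Equations.** Let $\pi\colon E\to M$ be a vector bundle of rank $1$ over a two-dimensional manifold $M$ with local coordinates $x,y$ (one unknown function $u$, with jet coordinates $u_\sigma$). A differential equation is the infinite prolongation $\mathcal{E}\subset J^\infty(\pi)$ of a smooth submanifold of some $J^k(\pi)$: if the submanifold is $\{F^1=\dots=F^r=0\}$, then $\mathcal{E}=\{D_\sigma(F^j)=0\text{ for all }j,\sigma\}$, where $D_x=\partial_x+\sum_\sigma u_{\sigma x}\,\partial_{u_\sigma}$ and $D_y=\partial_y+\sum_\sigma u_{\sigma y}\,\partial_{u_\sigma}$ are the total derivatives. They restrict to commuting vector fields on $\mathcal{E}$. $\mathcal{F}(\cdot)$ denotes the algebra of smooth functions; on $\mathcal{E}$ a smooth function depends on finitely many jet coordinates. **Coverings.** A (differential) covering of rank $l$ over $\mathcal{E}$ is a locally trivial fiber bundle $\tau\colon\tilde{\mathcal{E}}\to\mathcal{E}$ with $l$-dimensional fibers together with commuting vector fields $\tilde D_x,\tilde D_y$ on $\tilde{\mathcal{E}}$ that project under $\tau$ to $D_x,D_y$. Coverings over $\tilde{\mathcal{E}}$ are defined in the same way, with $\tilde D_x,\tilde D_y$ in place of $D_x,D_y$. A system $w_x=X$, $w_y=Y$ stands for the covering with fiber coordinate $w$ and total derivatives $D_x+X\partial_w$, $D_y+Y\partial_w$. In particular, $\tau^{\mathbf I}$ is the rank $1$ covering over $\tilde{\mathcal{E}}$ with fiber coordinate $\psi$ and total derivatives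 $\tilde D_x+\frac{\partial X}{\partial w}\psi\,\partial_\psi$, $\tilde D_y+\frac{\partial Y}{\partial w}\psi\,\partial_\psi$. **Differential connectedness, irreducibility.** $\mathcal{E}$ is differentially connected if the only $f\in\mathcal{F}(\mathcal{E})$ with $D_x(f)=D_y(f)=0$ are constants. The covering $\tau$ is irreducible if the only $f\in\mathcal{F}(\tilde{\mathcal{E}})$ with $\tilde D_x(f)=\tilde D_y(f)=0$ are constants. **Conservation laws.** On $\mathcal{E}$ (respectively $\tilde{\mathcal{E}}$), a horizontal $1$-form is $\omega=a\,dx+b\,dy$ with $a,b$ smooth functions. It is closed if $D_x(b)=D_y(a)$ (respectively $\tilde D_x(b)=\tilde D_y(a)$) and exact if $a=D_x(f)$, $b=D_y(f)$ (respectively $a=\tilde D_x(f)$, $b=\tilde D_y(f)$) for some smooth function $f$. $H_h^1$ denotes closed horizontal $1$-forms modulo exact ones. A conservation law is an element of $H_h^1$, nontrivial if nonzero. Conservation laws of $\tilde{\mathcal{E}}$ are called nonlocal conservation laws of $\mathcal{E}$. **Abelian coverings.** A covering $\tau$ of rank $l<\infty$ is Abelian if there exist $l$ linearly independent conservation laws $[\omega_i]\in H_h^1(\mathcal{E})$, $i=1,\dots,l$, such that the forms $\tau^*(\omega_i)$ are exact on $\tilde{\mathcal{E}}$. Thus a rank $1$ covering is non-Abelian if no nontrivial conservation law of $\mathcal{E}$ becomes exact when pulled back to $\tilde{\mathcal{E}}$. *)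

(* Defs.v *)
From HB Require Import structures.
From mathcomp Require Import all_boot all_order all_algebra.
From mathcomp Require Import all_classical all_reals all_analysis.

Set Implicit Arguments.
Unset Strict Implicit.
Unset Printing Implicit Defensive.

Import Order.TTheory GRing.Theory Num.Theory.
Import numFieldNormedType.Exports.

Local Open Scope classical_set_scope.
Local Open Scope ring_scope.

(* Everything lives in adapted coordinates.  A point is a family of real
   coordinates indexed by a possibly infinite type I, with the product
   topology; the functions considered depend on finitely many coordinates. *)
Notation pt R I := {ptws I -> R}.

Section SmoothFunctions.
Variables (R : realType) (I : choiceType).
Implicit Types (i : I) (p q : pt R I) (f : pt R I -> R).
Implicit Types (B : set I) (O S : set (pt R I)).

Definition pderiv i f : pt R I -> R :=
  fun p => derive1 (fun t : R => f (dfwith p i t)) (p i).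

Fixpoint Cn (n : nat) O f : Prop :=
  {in O, continuous f} /\
  (if n is m.+1 then
     forall i, (forall p, O p -> derivable (fun t : R => f (dfwith p i t)) (p i) 1)
               /\ Cn m O (pderiv i f)
   else True).

(* O is the preimage of an open subset of R^B. *)
Definition open_over B O : Prop :=
  open O /\ forall p q, (forall i, B i -> p i = q i) -> O p -> O q.

(* f restricted to O is the pullback of a smooth function on an open subset of
   R^B. *)
Definition smooth_on B O f : Prop :=
  [/\ open_over B O,
      forall p q, (forall i, B i -> p i = q i) -> O p -> O q -> f p = f q
    & forall n, Cn n O f].

(* A smooth function on a set S of points is represented by a function which
   is smooth on a neighbourhood of S.  Only its values on S matter: two
   representatives which agree on S stand for the same function. *)
Definition smooth S f : Prop :=
  exists B O, [/\ finite_set B, S `<=` O & smooth_on B O f].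

(* The components of the vector field \sum_i A_i \partial_i. *)
Definition vfield := I -> pt R I -> R.

(* For f depending on finitely many coordinates the sum has finite support. *)
Definition vact (A : vfield) f : pt R I -> R :=
  fun p => \sum_(i \in [set: I]) A i p * pderiv i f p.

(* A is tangent to S, so that its action descends to functions on S. *)
Definition restricts_to (A : vfield) S : Prop :=
  forall f, smooth S f -> (forall p, S p -> f p = 0) ->
  forall p, S p -> vact A f p = 0.

End SmoothFunctions.

(* A set of points with its total derivatives: an equation or a covering. *)
Record diffiety (R : realType) := Diffiety {
  coordT : choiceType;
  locus : set (pt R coordT);
  Dx : vfield R coordT;
  Dy : vfield R coordT
}.

Arguments coordT {R} d.
Arguments locus {R} d.
Arguments Dx {R} d.
Arguments Dy {R} d.

Section Diffieties.
Variables (R : realType) (E : diffiety R).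
Local Notation fn := (pt R (coordT E) -> R).

Definition commuting : Prop :=
  forall f : fn, smooth (locus E) f -> forall p, locus E p ->
  vact (Dx E) (vact (Dy E) f) p = vact (Dy E) (vact (Dx E) f) p.

Definition diff_connected : Prop :=
  forall f : fn, smooth (locus E) f ->
  (forall p, locus E p -> vact (Dx E) f p = 0 /\ vact (Dy E) f p = 0) ->
  exists c : R, forall p, locus E p -> f p = c.

(* The pair (a, b) stands for the horizontal form a dx + b dy. *)
Definition hform : Type := fn * fn.

Definition closed_form (w : hform) : Prop :=
  [/\ smooth (locus E) w.1, smooth (locus E) w.2
    & forall p, locus E p -> vact (Dx E) w.2 p = vact (Dy E) w.1 p].

Definition exact_form (w : hform) : Prop :=
  exists2 f : fn, smooth (locus E) f &
  forall p, locus E p -> w.1 p = vact (Dx E) f p /\ w.2 p = vact (Dy E) f p.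

Definition lin_comb (l : nat) (c : 'I_l -> R) (w : 'I_l -> hform) : hform :=
  (fun p => \sum_(i < l) c i * (w i).1 p,
   fun p => \sum_(i < l) c i * (w i).2 p).

(* The closed form w represents a nonzero class modulo exact forms. *)
Definition nontrivial_claw (w : hform) : Prop :=
  closed_form w /\ ~ exact_form w.

(* Linear independence of the classes of the closed forms w_i modulo exact
   forms. *)
Definition claws_independent (l : nat) (w : 'I_l -> hform) : Prop :=
  forall c : 'I_l -> R, exact_form (lin_comb c w) -> forall i, c i = 0.

End Diffieties.

Section Coverings.
Variables (R : realType) (E : diffiety R) (l : nat).

Definition tot_coord : choiceType := (coordT E + 'I_l)%type.

Definition proj_base (p : pt R tot_coord) : pt R (coordT E) :=
  fun i => p (inl i).

Definition proj_fibre (p : pt R tot_coord) : pt R 'I_l :=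
  fun j => p (inr j).

(* A + \sum_j X_j \partial_{w_j} *)
Definition lift_vfield (A : vfield R (coordT E))
    (X : 'I_l -> pt R tot_coord -> R) : vfield R tot_coord :=
  fun c p => match c with inl i => A i (proj_base p) | inr j => X j p end.

(* The trivial bundle with fibre W over the locus of E, with the total
   derivatives Dx + \sum_j X_j \partial_{w_j}, Dy + \sum_j Y_j \partial_{w_j};
   in a trivialization every pair of vector fields projecting to Dx, Dy has
   this form. *)
Definition total_space (W : set (pt R 'I_l))
    (X Y : 'I_l -> pt R tot_coord -> R) : diffiety R :=
  @Diffiety R tot_coord [set p | locus E (proj_base p) /\ W (proj_fibre p)]
    (lift_vfield (Dx E) X) (lift_vfield (Dy E) Y).

Definition is_covering (W : set (pt R 'I_l))
    (X Y : 'I_l -> pt R tot_coord -> R) : Prop :=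
  [/\ open W, W !=set0,
      forall j, smooth (locus (total_space W X Y)) (X j),
      forall j, smooth (locus (total_space W X Y)) (Y j)
    & commuting (total_space W X Y)].

Definition irreducible_covering (W : set (pt R 'I_l))
    (X Y : 'I_l -> pt R tot_coord -> R) : Prop :=
  diff_connected (total_space W X Y).

Definition pullback (W : set (pt R 'I_l))
    (X Y : 'I_l -> pt R tot_coord -> R) (w : hform E) :
    hform (total_space W X Y) :=
  (w.1 \o proj_base, w.2 \o proj_base).

Definition abelian_covering (W : set (pt R 'I_l))
    (X Y : 'I_l -> pt R tot_coord -> R) : Prop :=
  exists w : 'I_l -> hform E,
    [/\ forall i, closed_form (w i), claws_independent w
      & forall i, exact_form (pullback W X Y (w i))].

End Coverings.

(* Jet coordinates of one unknown u(x, y): ju i j is the derivative of u taken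
   i times in x and j times in y. *)
Inductive jcoord := jx | jy | ju of nat & nat.

Definition jcoord_encode (c : jcoord) : bool + nat * nat :=
  match c with jx => inl true | jy => inl false | ju i j => inr (i, j) end.

Definition jcoord_decode (c : bool + nat * nat) : jcoord :=
  match c with inl b => if b then jx else jy | inr ij => ju ij.1 ij.2 end.

Lemma jcoord_encodeK : cancel jcoord_encode jcoord_decode.
Proof. by case. Qed.

HB.instance Definition _ := Countable.copy jcoord (can_type jcoord_encodeK).

Section Equations.
Variable R : realType.
Local Notation jet := (pt R jcoord).

(* The index set of the coordinates on J^k. *)
Definition jets_upto (k : nat) : set jcoord :=
  [set c | if c is ju i j then (i + j <= k)%N else true].

Definition total_x : vfield R jcoord := fun c p =>
  match c with jx => 1 | jy => 0 | ju i j => p (ju i.+1 j) end.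

Definition total_y : vfield R jcoord := fun c p =>
  match c with jx => 0 | jy => 1 | ju i j => p (ju i j.+1) end.

Definition total_iter (i j : nat) (f : jet -> R) : jet -> R :=
  iter i (vact total_x) (iter j (vact total_y) f).

Definition prolongation (r : nat) (U : set jet) (F : 'I_r -> jet -> R) :
    diffiety R :=
  @Diffiety R jcoord
    [set p | U p /\ forall (m : 'I_r) (i j : nat), total_iter i j (F m) p = 0]
    total_x total_y.

(* U is an open domain in J^k on which the functions F^1, .., F^r are smooth,
   with differentials linearly independent along {F = 0}, so that {F = 0} is a
   submanifold of U.  The infinite prolongation is nonempty and the total
   derivatives restrict to it; the latter is part of the notion of equation
   and can fail for a set merely cut out by all the D_sigma F^m. *)
Definition is_equation (k r : nat) (U : set jet) (F : 'I_r -> jet -> R) : Prop :=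
  open_over (jets_upto k) U /\
  [/\ forall m, smooth_on (jets_upto k) U (F m),
      forall p, U p -> (forall m, F m p = 0) -> forall c : 'I_r -> R,
        (forall i, \sum_(m < r) c m * pderiv i (F m) p = 0) ->
        forall m, c m = 0,
      locus (prolongation U F) !=set0,
      restricts_to total_x (locus (prolongation U F))
    & restricts_to total_y (locus (prolongation U F))].

End Equations.

(* Main.v *)
(* Suppose that Xw dx + Yw dy = df on the covering, w being the fibre coordinate.
   Then e^f d/dw commutes with the total derivatives, and it becomes d/dv in the
   new fibre coordinate v = \int_{w0}^w e^{-f}.  Hence the total derivatives of v
   do not depend on the fibre, so that dv is the pullback of a closed form om on
   the base: om becomes exact on the covering.  If moreover c om = dh on the base,
   then c v - h is a first integral of the covering, hence constant, and c = 0
   since v is strictly monotone in w.  So the covering is Abelian.  The integral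
   makes sense because irreducibility forces the fibre to be an interval. *)

Require Import Defs.
From HB Require Import structures.
From mathcomp Require Import finmap.
From mathcomp Require Import all_boot all_order all_algebra.
From mathcomp Require Import all_classical all_reals all_analysis.
From mathcomp Require Import ring lra.

Set Implicit Arguments.
Unset Strict Implicit.
Unset Printing Implicit Defensive.

Import Order.TTheory GRing.Theory Num.Theory.
Import numFieldNormedType.Exports.

Local Open Scope classical_set_scope.
Local Open Scope ring_scope.

(** * Partial derivatives along coordinate lines *)

Section Lines.
Variables (R : realType) (I : choiceType).
Implicit Types (i j : I) (p q : pt R I) (f g : pt R I -> R) (s t : R).

(** The field d/dw fails to commute with the total derivatives only by the multiples [Xw] and [Yw]
    of itself, because the base components do not involve w; a factor e^f absorbs this defect
    exactly when [Xw] and [Yw] are the total derivatives of f. Normalizing v to vanish on the slice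
    w = w0 makes om explicit: it is e^{-f} (X dx + Y dy) restricted to that slice. Two obstacles
    shape the argument. The locus is not open, and functions on it are known only through
    representatives: an identity that holds only there need not survive a partial derivative along
    the base, but it does survive d/dw, since the fibre is open. Moreover a point has infinitely
    many coordinates, so smoothness is expressed by iterated partial derivatives, and the chain
    rule, the symmetry of second derivatives and differentiation under the integral sign are derived
    along coordinate lines. For the integral, the substitution s = w0 + t (w - w0) gives the fixed
    domain [0, 1], whose compactness yields the uniform estimates. *)

Lemma dfwith_id p i : dfwith p i (p i) = p.
Proof. by apply/funext => j; case: dfwithP. Qed.

Lemma dfwithE p i t j : dfwith p i t j = if i == j then t else p j.
Proof.
by have [<-|ij] := eqVneq i j; [rewrite dfwithin|rewrite dfwithout].
Qed.

Lemma dfwith_dfwith p i s t : dfwith (dfwith p i s) i t = dfwith p i t.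
Proof.
apply/funext => j; have [<-|ij] := eqVneq i j; first by rewrite !dfwithin.
by rewrite !dfwithout.
Qed.

Lemma dfwithC p i j s t : i != j ->
  dfwith (dfwith p i s) j t = dfwith (dfwith p j t) i s.
Proof.
move=> ij; apply/funext => k.
have [<-|jk] := eqVneq j k; first by rewrite dfwithin dfwithout ?dfwithin.
rewrite dfwithout//; have [<-|ik] := eqVneq i k; first by rewrite !dfwithin.
by rewrite !dfwithout.
Qed.

(** The product topology is the initial one for the projections, so convergence may be tested on
    each coordinate. *)
Lemma continuous_ptP (T : topologicalType) (Phi : T -> pt R I) (x : T) :
  (forall i, (fun y => Phi y i) @ x --> Phi x i) -> Phi @ x --> Phi x.
Proof.
move=> h; apply/cvg_sup => i; apply/cvg_image.
  by rewrite eqEsubset; split=> // t _; exists (fun=> t).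
move=> A /h nA; exists ((fun p : pt R I => p i) @^-1` A) => //.
rewrite image_preimage//; rewrite eqEsubset; split=> // t _; by exists (fun=> t).
Qed.

Lemma continuous_coord i : continuous (fun p => p i).
Proof. exact: (@proj_continuous I (fun=> R) i). Qed.

Lemma continuous_line p i : continuous (fun t => dfwith p i t : pt R I).
Proof. exact: (@dfwith_continuous I (fun=> R) p i). Qed.

Lemma near_line (O : set (pt R I)) p i : open O -> O p ->
  \forall t \near p i, O (dfwith p i t).
Proof.
move=> oO Op; apply: (@continuous_line p i (p i)).
by rewrite dfwith_id; apply: open_nbhs_nbhs.
Qed.

Lemma pderiv_is_derive i f p d :
  is_derive (p i) 1 (fun t => f (dfwith p i t)) d -> pderiv i f p = d.
Proof. by move=> h; rewrite /pderiv derive1E derive_val. Qed.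

Lemma near_eq_pderiv (O : set (pt R I)) f g p i : open O -> O p ->
  (forall q, O q -> f q = g q) -> pderiv i f p = pderiv i g p.
Proof.
move=> oO Op fg; rewrite /pderiv !derive1E; apply: near_eq_derive.
by apply: filterS (near_line i oO Op) => t /fg.
Qed.

Lemma near_eq_continuous (O : set (pt R I)) f g p : open O -> O p ->
  (forall q, O q -> f q = g q) -> {for p, continuous f} -> {for p, continuous g}.
Proof.
move=> oO Op fg; rewrite /prop_for /continuous_at -fg// => cf.
have nfg : \forall q \near p, f q = g q.
  by apply: filterS (open_nbhs_nbhs (conj oO Op)) => q /fg.
exact: cvg_trans (near_eq_cvg nfg) cf.
Qed.

End Lines.

(** * Functions of class C^n on open sets *)

Section Cn.
Variables (R : realType) (I : choiceType).
Implicit Types (i j : I) (p q : pt R I) (f g : pt R I -> R) (s t : R).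
Implicit Types (O : set (pt R I)) (n : nat).

(** Unlike the total function [pderiv], this carries the existence of the derivative together with
    its value. *)
Definition is_pderiv i f p d :=
  is_derive (p i) 1 (fun t : R => f (dfwith p i t)) d.

Lemma Cn_continuous n O f p : Cn n O f -> O p -> {for p, continuous f}.
Proof. by case: n => [|n] [cf _] Op; apply: cf; rewrite inE. Qed.

Lemma Cn_is_pderiv n O f p i :
  Cn n.+1 O f -> O p -> is_pderiv i f p (pderiv i f p).
Proof.
by move=> [_ /(_ i)[df _]] Op; rewrite /is_pderiv /pderiv derive1E; apply/derivableP/df.
Qed.

Lemma Cn_pderiv n O f i : Cn n.+1 O f -> Cn n O (pderiv i f).
Proof. by move=> [_ /(_ i)[]]. Qed.

Lemma eq_Cn n O f g : open O -> (forall p, O p -> f p = g p) ->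
  Cn n O f -> Cn n O g.
Proof.
move=> oO; elim: n f g => [|n IHn] f g fg [cf df]; split=> //.
- by move=> p pO; apply: near_eq_continuous fg (cf p pO) => //; exact: set_mem.
- by move=> p pO; apply: near_eq_continuous fg (cf p pO) => //; exact: set_mem.
- move=> i; have [dif Cf] := df i; split.
    move=> p Op; apply: near_eq_derivable (dif p Op).
    by apply: filterS (near_line i oO Op) => t /fg.
  by apply: IHn Cf => p Op; exact: near_eq_pderiv Op fg.
Qed.

Lemma sub_Cn n O O' f : O' `<=` O -> Cn n O f -> Cn n O' f.
Proof.
move=> O'O; elim: n f => [|n IHn] f [cf df]; split=> //.
- by move=> p; rewrite inE => /O'O Op; apply: cf; rewrite inE.
- by move=> p; rewrite inE => /O'O Op; apply: cf; rewrite inE.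
- by move=> i; have [dif Cf] := df i; split; [move=> p /O'O; exact: dif|exact: IHn].
Qed.

(** Lets a derivative be given by a formula [d] valid on [O] only, whereas [pderiv i f] may take
    other values outside [O]. *)
Lemma CnS n O f : open O -> {in O, continuous f} ->
  (forall i, exists d, (forall p, O p -> is_pderiv i f p (d p)) /\ Cn n O d) ->
  Cn n.+1 O f.
Proof.
move=> oO cf df; split=> // i; have [d [fd Cd]] := df i; split.
  by move=> p Op; have := fd p Op; case.
by apply: eq_Cn Cd => // p Op; apply/esym/pderiv_is_derive/fd.
Qed.

Lemma Cn_le m n O f : (m <= n)%N -> Cn n O f -> Cn m O f.
Proof.
elim: m n f => [|m IHm] [|n] f //; first by move=> _ [cf _]; split.
rewrite ltnS => mn [cf df]; split=> // i; have [dif Cf] := df i.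
by split=> //; exact: IHm Cf.
Qed.

Lemma is_pderivD i f g p a b : is_pderiv i f p a -> is_pderiv i g p b ->
  is_pderiv i (fun q => f q + g q) p (a + b).
Proof. by move=> fa gb; exact: is_deriveD. Qed.

Lemma is_pderivM i f g p a b : is_pderiv i f p a -> is_pderiv i g p b ->
  is_pderiv i (fun q => f q * g q) p (f p * b + g p * a).
Proof.
move=> fa gb; have := is_deriveM fa gb; rewrite dfwith_id; exact.
Qed.

Lemma is_pderiv_cst i c p : is_pderiv i (fun=> c) p 0.
Proof. exact: is_derive_cst. Qed.

Lemma is_pderiv_coord i j p : is_pderiv i (fun q => q j) p (i == j)%:R.
Proof.
rewrite /is_pderiv; have [<-|ij] := eqVneq i j.
  by under eq_fun do rewrite dfwithin; exact: is_derive_id.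
by under eq_fun do rewrite dfwithout//; exact: is_derive_cst.
Qed.

Lemma Cn_cst n O c : open O -> Cn n O (fun=> c).
Proof.
move=> oO; elim: n c => [|n IHn] c; first by split=> // p _; exact: (@cst_continuous (pt R I) R c p).
apply: CnS => //; first by move=> p _; exact: (@cst_continuous (pt R I) R c p).
by move=> i; exists (fun=> 0); split=> [p _|//]; exact: is_pderiv_cst.
Qed.

Lemma Cn_coord n O i : open O -> Cn n O (fun p => p i).
Proof.
case: n => [|n] oO; first by split=> // p _; exact: continuous_coord.
apply: CnS => //; first by move=> p _; exact: continuous_coord.
move=> j; exists (fun=> (j == i)%:R); split=> [p _|]; last exact: Cn_cst.
exact: is_pderiv_coord.
Qed.

Lemma CnD n O f g : open O -> Cn n O f -> Cn n O g ->
  Cn n O (fun p => f p + g p).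
Proof.
move=> oO; elim: n f g => [|n IHn] f g Cf Cg.
  split=> // p; rewrite inE => Op; apply: continuousD.
    exact: Cn_continuous Cf Op.
  exact: Cn_continuous Cg Op.
apply: CnS => //.
  move=> p; rewrite inE => Op; apply: continuousD.
    exact: Cn_continuous Cf Op.
  exact: Cn_continuous Cg Op.
move=> i; exists (fun p => pderiv i f p + pderiv i g p); split.
  move=> p Op; have fa := Cn_is_pderiv i Cf Op; have gb := Cn_is_pderiv i Cg Op.
  exact: is_pderivD fa gb.
by apply: IHn; exact: Cn_pderiv.
Qed.

Lemma CnM n O f g : open O -> Cn n O f -> Cn n O g ->
  Cn n O (fun p => f p * g p).
Proof.
move=> oO; elim: n f g => [|n IHn] f g Cf Cg.
  split=> // p; rewrite inE => Op; apply: continuousM.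
    exact: Cn_continuous Cf Op.
  exact: Cn_continuous Cg Op.
apply: CnS => //.
  move=> p; rewrite inE => Op; apply: continuousM.
    exact: Cn_continuous Cf Op.
  exact: Cn_continuous Cg Op.
move=> i; exists (fun p => f p * pderiv i g p + g p * pderiv i f p); split.
  move=> p Op; have fa := Cn_is_pderiv i Cf Op; have gb := Cn_is_pderiv i Cg Op.
  exact: is_pderivM fa gb.
apply: CnD => //; apply: IHn; try exact: Cn_pderiv.
  exact: Cn_le Cf.
exact: Cn_le Cg.
Qed.

Lemma is_pderiv_expR i f p a : is_pderiv i f p a ->
  is_pderiv i (fun q => expR (f q)) p (expR (f p) * a).
Proof.
move=> fa; have := @is_derive1_comp _ expR (fun t => f (dfwith p i t)) (p i) _ _ (is_derive_expR _) fa.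
by rewrite /= dfwith_id mulrC.
Qed.

Lemma Cn_expR n O f : open O -> Cn n O f -> Cn n O (fun p => expR (f p)).
Proof.
move=> oO; elim: n f => [|n IHn] f Cf.
  split=> // p; rewrite inE => Op; apply: continuous_comp; first exact: Cn_continuous Cf Op.
  exact: continuous_expR.
apply: CnS => //.
  move=> p; rewrite inE => Op; apply: continuous_comp; first exact: Cn_continuous Cf Op.
  exact: continuous_expR.
move=> i; exists (fun p => expR (f p) * pderiv i f p); split.
  by move=> p Op; apply: is_pderiv_expR; exact: (Cn_is_pderiv i Cf Op).
apply: CnM => //; last exact: Cn_pderiv.
by apply: IHn; exact: Cn_le Cf.
Qed.

End Cn.

Section Comp.
Variables (R : realType) (I J : choiceType).

(* Restricting the chain rule to maps that move a single coordinate, affinely,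
   along each coordinate line reduces it to one variable. *)
Lemma is_pderiv_comp (Phi : pt R J -> pt R I) (g : pt R I -> R) j i (m : R) q d :
  (forall t, Phi (dfwith q j t) = dfwith (Phi q) i (Phi q i + m * (t - q j))) ->
  is_pderiv i g (Phi q) d -> is_pderiv j (g \o Phi) q (m * d).
Proof.
move=> hPhi gd; rewrite /is_pderiv /=.
under eq_fun do rewrite hPhi.
have h : is_derive (q j) 1 (fun t => Phi q i + m * (t - q j)) m.
  by apply: is_derive_eq; rewrite add0r subr0 mul1r [LHS]mulr1.
have e : Phi q i + m * (q j - q j) = Phi q i by rewrite subrr mulr0 addr0.
have gd' : is_derive (Phi q i + m * (q j - q j)) 1 (fun t => g (dfwith (Phi q) i t)) d.
  by rewrite e.
rewrite mulrC; exact: (@is_derive1_comp _ (fun t => g (dfwith (Phi q) i t))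
  (fun t => Phi q i + m * (t - q j)) (q j) d m gd' h).
Qed.

(** Each partial derivative of [g \o Phi] is a single product [m * (pderiv i g \o Phi)], whose
    second factor falls under the induction hypothesis. The speed [m] may vary from line to line. *)
Lemma Cn_comp n (O : set (pt R I)) (O' : set (pt R J)) (Phi : pt R J -> pt R I)
    (g : pt R I -> R) : open O' ->
  (forall q, O' q -> O (Phi q)) ->
  (forall q, O' q -> {for q, continuous Phi}) ->
  (forall j, exists i, exists2 m : pt R J -> R, forall k, Cn k O' m & forall q t,
     Phi (dfwith q j t) = dfwith (Phi q) i (Phi q i + m q * (t - q j))) ->
  Cn n O g -> Cn n O' (g \o Phi).
Proof.
move=> oO' OO cPhi hPhi; elim: n g => [|n IHn] g Cg.
  split=> // q; rewrite inE => Oq; apply: continuous_comp; first exact: cPhi.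
  exact: Cn_continuous Cg (OO _ Oq).
apply: CnS => //.
  move=> q; rewrite inE => Oq; apply: continuous_comp; first exact: cPhi.
  exact: Cn_continuous Cg (OO _ Oq).
move=> j; have [i [m Cm hm]] := hPhi j.
exists (fun q => m q * (pderiv i g \o Phi) q); split.
  by move=> q Oq; apply: is_pderiv_comp => //; apply: Cn_is_pderiv Cg _; exact: OO.
by apply: CnM => //; apply: IHn; exact: Cn_pderiv.
Qed.

End Comp.

(** * Mean values and symmetry of second derivatives *)

Section Schwarz.
Variables (R : realType) (I : choiceType).
Implicit Types (i j : I) (p q : pt R I) (f g : pt R I -> R) (s t : R).
Implicit Types (O : set (pt R I)) (n : nat).

Lemma is_derive_line O f p i t : Cn 1 O f -> O (dfwith p i t) ->
  is_derive t 1 (fun s => f (dfwith p i s)) (pderiv i f (dfwith p i t)).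
Proof.
move=> Cf Ot; have := Cn_is_pderiv i Cf Ot; rewrite /is_pderiv dfwithin.
by under eq_fun do rewrite dfwith_dfwith.
Qed.

(** The parametrization by [0, 1] avoids any assumption on the order of [a] and [b], which may even
    coincide. *)
Lemma MVT_between (f df : R -> R) (a b : R) :
  (forall u : R, 0 <= u <= 1 -> is_derive (a + u * (b - a)) 1 f (df (a + u * (b - a)))) ->
  exists2 u : R, 0 <= u <= 1 & f b - f a = df (a + u * (b - a)) * (b - a).
Proof.
move=> fd; pose phi (u : R) := a + u * (b - a).
have dphi (u : R) : is_derive u 1 phi (b - a).
  have := is_deriveD (is_derive_cst a u 1) (is_deriveM (is_derive_id u 1) (is_derive_cst (b - a) u 1)).
  by rewrite scaler0 !add0r [_ *: 1]mulr1.
have dF (u : R) : 0 <= u <= 1 -> is_derive u 1 (f \o phi) (df (phi u) * (b - a)).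
  by move=> /fd fu; exact: is_derive1_comp.
have [||u] := @MVT_segment R (f \o phi) (fun u => df (phi u) * (b - a)) 0 1 ler01.
- by move=> u; rewrite in_itv/= => /andP[u0 u1]; apply: dF; rewrite !ltW.
- apply: derivable_within_continuous => u; rewrite in_itv/= => u01.
  by have [] := dF u u01.
- have phi1 : phi 1 = b by rewrite /phi mul1r addrC subrK.
  have phi0 : phi 0 = a by rewrite /phi mul0r addr0.
  by rewrite in_itv/= phi1 phi0 subr0 mulr1 => u01 e; exists u.
Qed.

Lemma MVT_dist (f df : R -> R) (a b : R) :
  (forall x, `|x - a| <= `|b - a| -> is_derive x 1 f (df x)) ->
  exists2 c, `|c - a| <= `|b - a| & f b - f a = df c * (b - a).
Proof.
have h (u : R) : 0 <= u <= 1 -> `|a + u * (b - a) - a| <= `|b - a|.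
  move=> /andP[u0 u1]; rewrite addrAC subrr add0r normrM ger0_norm//.
  by rewrite ler_piMl.
move=> fd; have [u u01|u u01 e] := @MVT_between f df a b; first by apply/fd/h.
by exists (a + u * (b - a)) => //; exact: h.
Qed.

Lemma near_box O p i j : open O -> O p -> exists2 e : R, 0 < e &
  forall s t, `|s - p i| <= e -> `|t - p j| <= e -> O (dfwith (dfwith p i s) j t).
Proof.
move=> oO Op.
pose Phi (x : R * R) : pt R I := dfwith (dfwith p i x.1) j x.2.
have cPhi : Phi @ (p i, p j) --> Phi (p i, p j).
  apply: continuous_ptP => k.
  have -> : Phi ^~ k = (fun y => if j == k then y.2 else if i == k then y.1 else p k).
    by apply/funext => y; rewrite /Phi !dfwithE.
  rewrite /Phi !dfwithE; case: eqP => _; first exact: cvg_snd.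
  by case: eqP => _; [exact: cvg_fst|exact: cvg_cst].
have PhiE : Phi (p i, p j) = p by rewrite /Phi/= !dfwith_id.
have /cPhi : nbhs (Phi (p i, p j)) O by rewrite PhiE; exact: open_nbhs_nbhs.
move=> /nbhs_ballP[e /= e0 he]; exists (e / 2); first by rewrite divr_gt0.
have e2 : e / 2 < e by rewrite ltr_pdivrMr// ltr_pMr// ltr1n.
move=> s t hs ht; apply: (he (s, t)); split; rewrite /ball/= distrC.
  exact: le_lt_trans hs e2.
exact: le_lt_trans ht e2.
Qed.

(** Two mean value steps: along [i] for the increment [G] of [f] in direction [j], then along [j]
    for [pderiv i f]. The left-hand side is symmetric in [i] and [j], which is what [pderivC]
    exploits. *)
Lemma second_difference O f p i j h : Cn 2 O f -> i != j -> 0 < h ->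
  (forall s t, `|s - p i| <= h -> `|t - p j| <= h -> O (dfwith (dfwith p i s) j t)) ->
  exists s t, [/\ `|s - p i| <= h, `|t - p j| <= h &
    f (dfwith (dfwith p i (p i + h)) j (p j + h)) - f (dfwith p i (p i + h))
    - f (dfwith p j (p j + h)) + f p =
    pderiv j (pderiv i f) (dfwith (dfwith p i s) j t) * h * h].
Proof.
move=> Cf ij h0 Obox; have C1 : Cn 1 O f by exact: Cn_le Cf.
have dh x : x + h - x = h by rewrite addrAC subrr add0r.
have hE x : `|x + h - x| = h by rewrite dh gtr0_norm.
have hh x : `|x + h - x| <= h by rewrite hE.
have h00 : `|p j - p j| <= h by rewrite subrr normr0 ltW.
pose G s := f (dfwith (dfwith p j (p j + h)) i s) - f (dfwith p i s).
pose dG s := pderiv i f (dfwith (dfwith p i s) j (p j + h))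
           - pderiv i f (dfwith (dfwith p i s) j (p j)).
have dfj s : dfwith (dfwith p i s) j (p j) = dfwith p i s.
  by rewrite dfwithC// dfwith_id.
have [s|s hs Gs] := @MVT_dist G dG (p i) (p i + h).
  rewrite hE => hs.
  apply: is_deriveB; rewrite ?dfj ?[dfwith (dfwith p i s) _ _]dfwithC//.
    apply: is_derive_line C1 _; rewrite -dfwithC//; exact: Obox.
  by apply: is_derive_line C1 _; rewrite -dfj; exact: Obox.
rewrite dh (gtr0_norm h0) in hs Gs.
have [t|t ht Ht] := @MVT_dist
    (fun t => pderiv i f (dfwith (dfwith p i s) j t))
    (fun t => pderiv j (pderiv i f) (dfwith (dfwith p i s) j t)) (p j) (p j + h).
  rewrite hE => ht.
  by apply: is_derive_line (Cn_pderiv _ Cf) _; exact: Obox.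
rewrite dh (gtr0_norm h0) in ht Ht.
exists s, t; split=> //.
rewrite -Ht -/(dG s) -Gs /G dfwith_id (dfwithC _ (p i + h) _ ij).
by rewrite -(dfwithC _ (p i) _ ij) dfwith_id; ring.
Qed.

Lemma pderivC O f p i j : open O -> Cn 2 O f -> O p ->
  pderiv i (pderiv j f) p = pderiv j (pderiv i f) p.
Proof.
move=> oO Cf Op; have [->//|ij] := eqVneq i j.
apply/eqP; rewrite -subr_eq0 -normr_le0; apply/ler_addgt0Pr => e e0; rewrite add0r.
have cA : {for p, continuous (pderiv i (pderiv j f))}.
  exact: Cn_continuous (Cn_pderiv i (Cn_pderiv j Cf)) Op.
have cB : {for p, continuous (pderiv j (pderiv i f))}.
  exact: Cn_continuous (Cn_pderiv j (Cn_pderiv i Cf)) Op.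
have e2 : 0 < e / 2 by rewrite divr_gt0.
have /cvgrPdist_lt/(_ _ e2) nA := cA.
have /cvgrPdist_lt/(_ _ e2) nB := cB.
pose N := [set q | O q /\
  (`|pderiv i (pderiv j f) p - pderiv i (pderiv j f) q| < e / 2 /\
   `|pderiv j (pderiv i f) p - pderiv j (pderiv i f) q| < e / 2)].
have Vp : nbhs p N.
  by apply: filterI (open_nbhs_nbhs (conj oO Op)) _; exact: filterI nA nB.
pose V := N^°.
have oV : open V by exact: open_interior.
have VO : V `<=` N by exact: interior_subset.
have [h h0 hV] := near_box i j oV Vp.
have CfV : Cn 2 V f by apply: sub_Cn Cf => q /VO[].
have ji : j != i by rewrite eq_sym.
have hV' t s : `|t - p j| <= h -> `|s - p i| <= h -> V (dfwith (dfwith p j t) i s).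
  by move=> ht hs; rewrite dfwithC//; exact: hV.
have [s [t [hs ht e1]]] := second_difference CfV ij h0 hV.
have [t' [s' [ht' hs' e2']]] := second_difference CfV ji h0 hV'.
have hn0 : h != 0 by rewrite gt_eqF.
(* Computed in either order, the second difference is h^2 times a mixed derivative, so the two mixed
   derivatives share a value at two points of the box. Each of them lies within [e / 2] of its value
   at [p]. *)
have E : pderiv j (pderiv i f) (dfwith (dfwith p i s) j t) =
         pderiv i (pderiv j f) (dfwith (dfwith p i s') j t').
  move: e1; rewrite -(dfwithC p (p j + h) (p i + h) ji) => e1.
  suff : pderiv j (pderiv i f) (dfwith (dfwith p i s) j t) * h * h =
         pderiv i (pderiv j f) (dfwith (dfwith p j t') i s') * h * h.
    by move=> /(mulIf hn0)/(mulIf hn0) ->; rewrite (dfwithC _ _ _ ij).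
  by rewrite -e1 -e2'; ring.
have /VO[_ [_ b1]] := hV _ _ hs ht.
have /VO[_ [b2 _]] := hV _ _ hs' ht'.
move: b1 b2; rewrite E; set c := pderiv i _ (dfwith _ _ _).
set a := pderiv i _ p; set b := pderiv j _ p => b1 b2; clearbody a b c.
have -> : a - b = (a - c) + (c - b) by rewrite addrA subrK.
apply: le_trans (ler_normD _ _) _.
rewrite [e in _ <= e]splitr; apply: lerD; first exact: ltW b2.
by rewrite distrC; exact: ltW b1.
Qed.

End Schwarz.

(** * Integrals depending on a parameter *)

Section Int01.
Variable R : realType.
Implicit Types (f g : R -> R).

Definition int01 f : R := (\int[@lebesgue_measure R]_(t in `[0%R, 1%R]) f t)%R.

Definition cont01 f := forall t : R, 0 <= t <= 1 -> {for t, continuous f}.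

Lemma cont01_within f : cont01 f -> {within `[0, 1], continuous f}.
Proof.
move=> cf; apply: continuous_in_subspaceT => t; rewrite inE/= in_itv/=.
exact: cf.
Qed.

Lemma cont01_integrable f : cont01 f ->
  (@lebesgue_measure R).-integrable `[0%R, 1%R] (EFin \o f).
Proof.
move=> cf; apply: continuous_compact_integrable; first exact: segment_compact.
exact: cont01_within.
Qed.

Lemma int01B f g : cont01 f -> cont01 g ->
  int01 (fun t => f t - g t) = int01 f - int01 g.
Proof. by move=> cf cg; apply: RintegralB => //; exact: cont01_integrable. Qed.

Lemma int01Z c f : cont01 f -> int01 (fun t => c * f t) = c * int01 f.
Proof. by move=> cf; apply: RintegralZl => //; exact: cont01_integrable. Qed.

Lemma int01D f g : cont01 f -> cont01 g ->
  int01 (fun t => f t + g t) = int01 f + int01 g.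
Proof. by move=> cf cg; apply: RintegralD => //; exact: cont01_integrable. Qed.

Lemma int01_le f e : cont01 f -> (forall t, 0 <= t <= 1 -> `|f t| <= e) ->
  `|int01 f| <= e.
Proof.
move=> cf fe; have mI : measurable (`[0%R, 1%R] : set (measurableTypeR R)) by [].
apply: le_trans (le_normr_Rintegral mI (cont01_integrable cf)) _.
have -> : e = (\int[@lebesgue_measure R]_(t in `[0%R, 1%R]) (fun=> e) t)%R.
  rewrite Rintegral_cst//= lebesgue_measure_itv/= lte_fin ltr01 oppr0 adde0.
  by rewrite /= mulr1.
have c1 : cont01 (fun t => `|f t|).
  by move=> t /cf ft; apply: continuous_comp ft _; exact: norm_continuous.
have c2 : cont01 (fun=> e) by move=> t _; exact: cst_continuous.
apply: (le_Rintegral mI (cont01_integrable c1) (cont01_integrable c2)).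
by move=> t; rewrite /= in_itv/=; exact: fe.
Qed.

Lemma int01_FTC2 (F f : R -> R) : cont01 f ->
  (forall t : R, 0 <= t <= 1 -> is_derive t 1 F (f t)) -> int01 f = F 1 - F 0.
Proof.
move=> cf Ff; rewrite /int01 /Rintegral (@continuous_FTC2 R f F)//.
- exact: cont01_within.
- have cF t : 0 <= t <= 1 -> {for t, continuous F}.
    by move=> /Ff [/derivable1_diffP/differentiable_continuous].
  split.
  + by move=> t; rewrite in_itv/= => /andP[t0 t1]; have [] := Ff t; rewrite ?ltW.
  + by apply: cvg_at_right_filter; apply: cF; rewrite lexx ler01.
  + by apply: cvg_at_left_filter; apply: cF; rewrite lexx ler01.
- move=> t; rewrite in_itv/= => /andP[t0 t1]; rewrite derive1E.
  by have [|_ ->] := Ff t; rewrite ?ltW.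
Qed.

(** The derivative as a first-order error bound, free of quotients: the form in which an estimate of
    an integral delivers it. *)
Lemma is_derive_le (f : R -> R) (x d : R) :
  (forall e, 0 < e -> \forall h \near 0, `|f (x + h) - f x - h * d| <= e * `|h|) ->
  is_derive x 1 f d.
Proof.
move=> H; have cf : (fun h => h^-1 *: ((f \o shift x) (h *: 1) - f x)) @ 0^' --> d.
  apply/cvgrPdist_le => e e0; near=> h.
  have h0 : h != 0 by near: h; exact: nbhs_dnbhs_neq.
  have K : `|f (x + h) - f x - h * d| <= e * `|h|.
    by near: h; apply: nbhs_dnbhs; exact: H.
  rewrite distrC /= [h *: 1]mulr1 (addrC h x).
  have -> : h^-1 *: (f (x + h) - f x) - d = h^-1 * (f (x + h) - f x - h * d).
    by rewrite mulrBr mulKf.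
  have hp : 0 < `|h| by rewrite normr_gt0.
  by rewrite normrM normfV (ler_pdivrMl _ _ hp) (mulrC `|h|); exact: K.
apply: DeriveDef; first by apply/cvg_ex; exists d.
exact: cvg_lim cf.
Unshelve. all: by end_near. Qed.

End Int01.

Section IntegralParameter.
Variables (R : realType) (I : choiceType).
Local Notation J := (I + 'I_1)%type.
Implicit Types (p q : pt R I) (t : R) (O : set (pt R J)) (G : pt R J -> R).

(** The index type [I + 'I_1] is also that of the coordinates on a rank one covering, so [snoc]
    serves both for the integration parameter and for the slices w = t. *)
Definition snoc p t : pt R J := fun c => if c is inl i then p i else t.

Definition tube01 O : set (pt R I) :=
  [set p | forall t, 0 <= t <= 1 -> O (snoc p t)].

Lemma continuous_snoc p t : (fun x : R * pt R I => snoc x.2 x.1) @ (t, p) --> snoc p t.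
Proof.
apply: (@continuous_ptP R _ _ (fun x : R * pt R I => snoc x.2 x.1) (t, p)).
case=> [i|j]; last exact: cvg_fst.
have h : (fun x : R * pt R I => x.2) @ (t, p) --> p by exact: cvg_snd.
exact: (cvg_comp _ _ h (@continuous_coord R I i p)).
Qed.

(** The tube lemma: compactness of [0, 1] gives one neighbourhood of [p] that works for every
    [t]. *)
Lemma near_cover01 (P : pt R I -> R -> Prop) p :
  (forall t : R, 0 <= t <= 1 -> \forall s \near t & q \near p, P q s) ->
  \forall q \near p, forall t : R, 0 <= t <= 1 -> P q t.
Proof.
move=> H; have /compact_near_coveringP cov := @segment_compact R 0 1.
apply: filterS (cov _ (nbhs p) P _ _).
  by move=> q Hq t t01; apply: Hq; rewrite /= in_itv.
by move=> t; rewrite /= in_itv/=; exact: H.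
Qed.

Lemma near_tube01 (P : pt R J -> Prop) p :
  (forall t, 0 <= t <= 1 -> nbhs (snoc p t) P) ->
  \forall q \near p, forall t, 0 <= t <= 1 -> P (snoc q t).
Proof. by move=> H; apply: near_cover01 => t /H nP; exact: continuous_snoc nP. Qed.

Lemma open_tube01 O : open O -> open (tube01 O).
Proof.
move=> oO; rewrite openE => p Op; apply: near_tube01 => t /Op Ot.
exact: open_nbhs_nbhs.
Qed.

Lemma continuous_snoc_l p t : {for t, continuous (fun s => snoc p s)}.
Proof.
apply: (@continuous_ptP R _ _ (fun s => snoc p s) t) => -[i|j] /=.
  exact: cvg_cst.
exact: cvg_id.
Qed.

Lemma near_tube01_dist O G p e : {in O, continuous G} -> tube01 O p -> 0 < e ->
  \forall q \near p, forall t, 0 <= t <= 1 -> `|G (snoc q t) - G (snoc p t)| < e.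
Proof.
move=> cG Op e0; have e2 : 0 < e / 2 by rewrite divr_gt0.
(* Near [(t, p)] both values of [G] are compared with the value at the centre [snoc p t]; this makes
   the estimate uniform in the parameter. *)
apply: near_cover01 => t t01.
have cGt : {for snoc p t, continuous G} by apply: cG; rewrite inE; exact: Op.
have cl : G \o (fun x : R * pt R I => snoc x.2 x.1) @ (t, p) --> G (snoc p t).
  exact: (cvg_comp _ _ (@continuous_snoc p t) cGt).
have cr : G \o (fun x : R * pt R I => snoc p x.1) @ (t, p) --> G (snoc p t).
  have h : (fun x : R * pt R I => x.1) @ (t, p) --> t by exact: cvg_fst.
  have h' := cvg_comp _ _ h (@continuous_snoc_l p t).
  exact: (cvg_comp _ _ h' cGt).
have /cvgrPdist_lt/(_ _ e2) n1 := cl.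
have /cvgrPdist_lt/(_ _ e2) n2 := cr.
apply: filterS2 n1 n2 => -[s q] /= n1 n2.
have -> : G (snoc q s) - G (snoc p s) =
  (G (snoc p t) - G (snoc p s)) - (G (snoc p t) - G (snoc q s)) by ring.
apply: le_lt_trans (ler_normB _ _) _.
by rewrite [ltRHS]splitr; exact: ltrD.
Qed.

Definition int_last G : pt R I -> R := fun p => int01 (fun t => G (snoc p t)).

Lemma cont01_snoc O G p : {in O, continuous G} -> tube01 O p ->
  cont01 (fun t => G (snoc p t)).
Proof.
move=> cG Op t t01; have cGt : {for snoc p t, continuous G}.
  by apply: cG; rewrite inE; exact: Op.
exact: (cvg_comp _ _ (@continuous_snoc_l p t) cGt).
Qed.

Lemma continuous_int_last O G : open O -> {in O, continuous G} ->
  {in tube01 O, continuous (int_last G)}.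
Proof.
move=> oO cG p; rewrite inE => Op.
suff : int_last G @ nbhs p --> int_last G p by [].
apply: (iffRL (@cvgrPdist_le _ _ _ (nbhs p) _ (int_last G) (int_last G p))) => e e0.
apply: filterS2 (near_tube01_dist cG Op e0) (open_nbhs_nbhs (conj (open_tube01 oO) Op)).
move=> q hq Oq; rewrite distrC /int_last -int01B; try exact: cont01_snoc cG _.
apply: int01_le => [t t01|t t01]; last exact: ltW (hq t t01).
apply: continuousB; first exact: (cont01_snoc cG Oq).
exact: (cont01_snoc cG Op).
Qed.

Lemma snoc_dfwith p i s t : snoc (dfwith p i s) t = dfwith (snoc p t) (inl i) s.
Proof.
by apply/funext => -[j|j]; rewrite !dfwithE//= dfwithE.
Qed.

(** Differentiation under the integral sign: for each [t] the mean value theorem bounds the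
    first-order error by |h| times the oscillation of the derivative of [G], which is small
    uniformly in [t]. *)
Lemma is_pderiv_int_last O G p i : open O -> Cn 1 O G -> tube01 O p ->
  is_pderiv i (int_last G) p (int_last (pderiv (inl i) G) p).
Proof.
move=> oO CG Op; have cG : {in O, continuous G} by have [] := CG.
have cdG : {in O, continuous (pderiv (inl i) G)}.
  by have [] := Cn_pderiv (inl i) CG.
have OT : open (tube01 O) := open_tube01 oO.
apply: is_derive_le => e e0; rewrite dfwith_id.
have := near_tube01_dist cdG Op e0.
move=> /(filterI (open_nbhs_nbhs (conj OT Op))).
(* The neighbourhood of [p] is pulled back to the line through [p] in direction [i], where it
   contains an interval of radius [d]. *)
rewrite -{1}(dfwith_id p i) => /(@continuous_line R I p i (p i)).
move=> /nbhs_ballP[d /= d0 hd].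
near=> h.
have hd' : `|h| < d.
  near: h; apply/nbhs_ballP; exists d => //= x.
  by rewrite /ball/= sub0r normrN.
have Hs s : `|s - p i| <= `|h| -> tube01 O (dfwith p i s) /\
    forall t, 0 <= t <= 1 -> `|pderiv (inl i) G (snoc (dfwith p i s) t)
                              - pderiv (inl i) G (snoc p t)| < e.
  by move=> hs; apply: hd; rewrite /ball/= distrC; exact: le_lt_trans hs hd'.
have hh : p i + h - p i = h by rewrite addrAC subrr add0r.
have Oh : tube01 O (dfwith p i (p i + h)) by apply Hs; rewrite hh.
have c1 := cont01_snoc cG Oh; have c2 := cont01_snoc cG Op.
have c3 := cont01_snoc cdG Op.
have c4 : cont01 (fun t => G (snoc (dfwith p i (p i + h)) t) - G (snoc p t)).
  by move=> t t01; apply: continuousB; [exact: c1|exact: c2].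
have c5 : cont01 (fun t => h * pderiv (inl i) G (snoc p t)).
  by move=> t t01; apply: continuousM; [exact: cst_continuous|exact: c3].
rewrite /int_last -int01B// -int01Z// -int01B//.
apply: int01_le => [t t01|t t01].
  by apply: continuousB; [exact: c4|exact: c5].
have [s|s hs] := @MVT_dist R (fun s => G (dfwith (snoc p t) (inl i) s))
    (fun s => pderiv (inl i) G (dfwith (snoc p t) (inl i) s)) (p i) (p i + h).
  rewrite hh => hs; apply: is_derive_line CG _.
  by rewrite -snoc_dfwith; apply Hs.
rewrite hh in hs *; rewrite -!snoc_dfwith dfwith_id => ->.
rewrite mulrC -mulrBr normrM mulrC ler_wpM2r//; apply: ltW.
by have [_] := Hs _ hs; apply.
Unshelve. all: by end_near. Qed.

Lemma Cn_int_last n O G : open O -> Cn n O G -> Cn n (tube01 O) (int_last G).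
Proof.
move=> oO; elim: n G => [|n IHn] G CG.
  by split=> //; apply: continuous_int_last => //; have [] := CG.
apply: CnS; first exact: open_tube01.
  by apply: continuous_int_last => //; have [] := CG.
move=> i; exists (int_last (pderiv (inl i) G)); split.
  by move=> p Op; apply: is_pderiv_int_last Op => //; exact: Cn_le CG.
by apply: IHn; exact: Cn_pderiv.
Qed.

End IntegralParameter.

(** * Smooth functions and vector fields *)

Section Smooth.
Variables (R : realType) (I : choiceType).
Implicit Types (i j : I) (p q : pt R I) (f g : pt R I -> R).
Implicit Types (B : set I) (O S : set (pt R I)).

Lemma open_overI B B' O O' : open_over B O -> open_over B' O' ->
  open_over (B `|` B') (O `&` O').
Proof.
move=> [ oO hO] [ oO' hO']; split; first exact: openI.
move=> p q pq [Op O'p]; split.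
  by apply: hO Op => i Bi; apply: pq; left.
by apply: hO' O'p => i Bi; apply: pq; right.
Qed.

Lemma sub_smooth_on B B' O O' f : B `<=` B' -> O' `<=` O -> open_over B' O' ->
  smooth_on B O f -> smooth_on B' O' f.
Proof.
move=> BB OO ov [_ hf Cf]; split=> //.
  by move=> p q pq /OO Op /OO Oq; apply: hf => // i /BB; exact: pq.
by move=> n; exact: sub_Cn (Cf n).
Qed.

Lemma smooth_common S f g : smooth S f -> smooth S g ->
  exists B O, [/\ finite_set B, S `<=` O, smooth_on B O f & smooth_on B O g].
Proof.
move=> [B [ O [fB SO sf]]] [B' [ O' [fB' SO' sg]]].
have ov : open_over (B `|` B') (O `&` O').
  by case: sf sg => [ o1 _ _] [ o2 _ _]; exact: open_overI.
exists (B `|` B'), (O `&` O'); split.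
- by rewrite finite_setU.
- by move=> p Sp; split; [exact: SO|exact: SO'].
- by apply: sub_smooth_on ov sf; [exact: subsetUl|exact: subIsetl].
- by apply: sub_smooth_on ov sg; [exact: subsetUr|exact: subIsetr].
Qed.

Lemma smooth_on_cst B O c : open_over B O -> smooth_on B O (fun=> c).
Proof. by move=> ov; split=> // n; apply: Cn_cst; case: ov. Qed.

Lemma smooth_cst S c : smooth S (fun=> c).
Proof.
exists set0, setT; split=> //; apply: smooth_on_cst; split=> //.
exact: openT.
Qed.

Lemma smooth_coord S i : smooth S (fun p => p i).
Proof.
exists [set i], setT; split=> //; split.
- by split; first exact: openT.
- by move=> p q pq _ _; exact: pq.
- by move=> n; apply: Cn_coord; exact: openT.
Qed.

Lemma smoothD S f g : smooth S f -> smooth S g -> smooth S (fun p => f p + g p).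
Proof.
move=> sf sg; have [B [ O [fB SO [ov hf Cf] [_ hg Cg]]]] := smooth_common sf sg.
exists B, O; split=> //; split=> //.
  by move=> p q pq Op Oq; rewrite (hf p q)// (hg p q).
by move=> n; apply: CnD => //; case: ov.
Qed.

Lemma smoothM S f g : smooth S f -> smooth S g -> smooth S (fun p => f p * g p).
Proof.
move=> sf sg; have [B [ O [fB SO [ov hf Cf] [_ hg Cg]]]] := smooth_common sf sg.
exists B, O; split=> //; split=> //.
  by move=> p q pq Op Oq; rewrite (hf p q)// (hg p q).
by move=> n; apply: CnM => //; case: ov.
Qed.

Lemma smooth_expR S f : smooth S f -> smooth S (fun p => expR (f p)).
Proof.
move=> [B [ O [fB SO [ov hf Cf]]]]; exists B, O; split=> //; split=> //.
  by move=> p q pq Op Oq; rewrite (hf p q).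
by move=> n; apply: Cn_expR => //; case: ov.
Qed.

Lemma smooth_sum S (T : eqType) (s : seq T) (F : T -> pt R I -> R) :
  (forall x, x \in s -> smooth S (F x)) -> smooth S (fun p => \sum_(x <- s) F x p).
Proof.
elim: s => [|x s IHs] sF; first by under eq_fun do rewrite big_nil; exact: smooth_cst.
under eq_fun do rewrite big_cons; apply: smoothD; first by apply: sF; exact: mem_head.
by apply: IHs => y ys; apply: sF; rewrite in_cons ys orbT.
Qed.

Lemma near_eq_smooth B O S f g : finite_set B -> open_over B O -> S `<=` O ->
  (forall p, O p -> f p = g p) -> smooth S f -> smooth S g.
Proof.
move=> fB ov SO fg [B' [ O' [fB' SO' sf]]].
have ov' : open_over (B `|` B') (O `&` O').
  by case: sf => o _ _; exact: open_overI.
have [] : smooth_on (B `|` B') (O `&` O') f.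
  by apply: sub_smooth_on ov' sf; [exact: subsetUr|exact: subIsetr].
move=> _ hf Cf; exists (B `|` B'), (O `&` O'); split.
- by rewrite finite_setU.
- by move=> p Sp; split; [exact: SO|exact: SO'].
split=> //.
  by move=> p q pq Op Oq; rewrite -(fg p (proj1 Op)) -(fg q (proj1 Oq)); exact: hf.
by move=> n; apply: eq_Cn (Cf n) => [|p []/fg//]; case: ov'.
Qed.

Lemma open_over_line B O p i t : open_over B O -> ~ B i -> O p -> O (dfwith p i t).
Proof.
move=> [_ hO] Bi; apply: hO => j Bj; rewrite dfwithE; case: eqP => // ij.
by exfalso; apply: Bi; rewrite ij.
Qed.

Lemma pderiv_out B O f p i : smooth_on B O f -> O p -> ~ B i -> pderiv i f p = 0.
Proof.
move=> [ov hf _] Op Bi; apply: pderiv_is_derive.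
have -> : (fun t => f (dfwith p i t)) = cst (f p); last exact: is_derive_cst.
apply/funext => t; apply: hf => // [j Bj|]; last exact: open_over_line ov Bi Op.
by rewrite dfwithE; case: eqP => // ij; exfalso; apply: Bi; rewrite ij.
Qed.

Lemma smooth_on_pderiv B O f i : smooth_on B O f -> smooth_on B O (pderiv i f).
Proof.
move=> sf; have [ov hf Cf] := sf; have [ oO hO] := ov; split=> //; last first.
  by move=> n; exact: Cn_pderiv (Cf n.+1).
move=> p q pq Op Oq; have [Bi|Bi] := pselect (B i); last first.
  by rewrite !(pderiv_out sf).
rewrite /pderiv !derive1E (pq i Bi); apply: near_eq_derive.
have np := near_line i oO Op; have nq := near_line i oO Oq.
rewrite (pq i Bi) in np; apply: filterS2 np nq => t Opt Oqt.
by apply: hf => // j Bj; rewrite !dfwithE; case: eqP => // _; exact: pq.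
Qed.

Lemma smooth_pderiv S f i : smooth S f -> smooth S (pderiv i f).
Proof.
move=> [B [ O [fB SO sf]]]; exists B, O; split=> //; exact: smooth_on_pderiv.
Qed.

Lemma smooth_is_pderiv S f p i : smooth S f -> S p -> is_pderiv i f p (pderiv i f p).
Proof. by move=> [B [ O [fB SO [_ _ Cf]]]] Sp; exact: Cn_is_pderiv (Cf 1) (SO _ Sp). Qed.

Lemma smooth_pderivC S f p i j : smooth S f -> S p ->
  pderiv i (pderiv j f) p = pderiv j (pderiv i f) p.
Proof.
move=> [B [ O [fB SO [[ oO _] _ Cf]]]] Sp.
by apply: pderivC (Cf 2) _ => //; exact: SO.
Qed.

End Smooth.

Section SmoothComp.
Variables (R : realType) (I J : choiceType).

(** [dep i] is a finite set of coordinates that determine the [i]-th coordinate of [Phi]; thus a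
    function of finitely many coordinates pulls back to one of the same kind. *)
Lemma smooth_comp (Phi : pt R J -> pt R I) (dep : I -> set J)
    (S : set (pt R I)) (S' : set (pt R J)) (f : pt R I -> R) :
  continuous Phi ->
  (forall i, finite_set (dep i)) ->
  (forall i q q', (forall j, dep i j -> q j = q' j) -> Phi q i = Phi q' i) ->
  (forall j, exists i, exists2 m : pt R J -> R, forall k, Cn k setT m & forall q t,
     Phi (dfwith q j t) = dfwith (Phi q) i (Phi q i + m q * (t - q j))) ->
  (forall q, S' q -> S (Phi q)) ->
  smooth S f -> smooth S' (f \o Phi).
Proof.
move=> cPhi fdep hdep hPhi SS [B [ O [fB SO [[ oO hO] hf Cf]]]].
have agree q q' : (forall j, (\bigcup_(i in B) dep i) j -> q j = q' j) ->
    forall i, B i -> Phi q i = Phi q' i.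
  by move=> qq i Bi; apply: hdep => j dj; apply: qq; exists i.
have oP : open (Phi @^-1` O) by apply: open_comp => // q _; exact: cPhi.
exists (\bigcup_(i in B) dep i), (Phi @^-1` O); split.
- by apply: bigcup_finite.
- by move=> q /SS/SO.
split.
- by split=> // q q' /agree qq; exact: hO.
- by move=> q q' /agree qq Oq Oq'; exact: hf.
- move=> n; apply: (@Cn_comp _ _ _ _ O) (Cf n) => //.
    by move=> q _; exact: cPhi.
  move=> j; have [i [m Cm hm]] := hPhi j; exists i, m => // k.
  exact: sub_Cn (Cm k).
Qed.

End SmoothComp.

(** * Vector fields as derivations and their Lie bracket *)

Section Vact.
Variables (R : realType) (I : choiceType).
Implicit Types (i j : I) (p q : pt R I) (f g : pt R I -> R).
Implicit Types (B : set I) (O S : set (pt R I)) (A C : vfield R I).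

Lemma vactE B O A f p : finite_set B -> smooth_on B O f -> O p ->
  vact A f p = \sum_(i <- fset_set B) A i p * pderiv i f p.
Proof.
move=> fB sf Op; apply: fsbigTE => i; rewrite in_fset_set// => /negP Bi.
rewrite (pderiv_out sf Op) ?mulr0// => Bi'; apply: Bi.
exact: mem_set.
Qed.

Lemma near_eq_vact O A f g p : open O -> O p -> (forall q, O q -> f q = g q) ->
  vact A f p = vact A g p.
Proof.
move=> oO Op fg; apply: eq_fsbigr => i _.
by rewrite (near_eq_pderiv i oO Op fg).
Qed.

Lemma vact_cst A c p : vact A (fun=> c) p = 0.
Proof.
by apply: fsbig1 => i _; rewrite (pderiv_is_derive (is_pderiv_cst i c p)) mulr0.
Qed.

Lemma vact_coord A i p : vact A (fun q => q i) p = A i p.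
Proof.
rewrite /vact (fsbigTE [fset i]%fset) => [|j].
  by rewrite big_seq_fset1 (pderiv_is_derive (is_pderiv_coord i i p)) eqxx mulr1.
rewrite inE => /negbTE ji.
by rewrite (pderiv_is_derive (is_pderiv_coord j i p)) ji mulr0.
Qed.

Lemma vactD S A f g p : smooth S f -> smooth S g -> S p ->
  vact A (fun q => f q + g q) p = vact A f p + vact A g p.
Proof.
move=> sf sg Sp; have [B [ O [fB SO sf' sg']]] := smooth_common sf sg.
have Op := SO _ Sp; have [[oO _] _ Cf] := sf'; have [_ _ Cg] := sg'.
have sfg : smooth_on B O (fun q => f q + g q).
  split; [by case: sf'| |by move=> n; exact: CnD oO (Cf n) (Cg n)].
  case: sf' sg' => _ hf _ [_ hg _] q q' qq Oq Oq'.
  by rewrite (hf q q')// (hg q q').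
rewrite !(vactE _ fB _ Op)// -big_split/=; apply: eq_bigr => i _.
have fi := smooth_is_pderiv i sf Sp; have gi := smooth_is_pderiv i sg Sp.
by rewrite (pderiv_is_derive (is_pderivD fi gi)) mulrDr.
Qed.

Lemma vactM S A f g p : smooth S f -> smooth S g -> S p ->
  vact A (fun q => f q * g q) p = f p * vact A g p + g p * vact A f p.
Proof.
move=> sf sg Sp; have [B [ O [fB SO sf' sg']]] := smooth_common sf sg.
have Op := SO _ Sp; have [[oO _] _ Cf] := sf'; have [_ _ Cg] := sg'.
have sfg : smooth_on B O (fun q => f q * g q).
  split; [by case: sf'| |by move=> n; exact: CnM oO (Cf n) (Cg n)].
  case: sf' sg' => _ hf _ [_ hg _] q q' qq Oq Oq'.
  by rewrite (hf q q')// (hg q q').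
rewrite !(vactE _ fB _ Op)// !mulr_sumr -big_split/=; apply: eq_bigr => i _.
have fi := smooth_is_pderiv i sf Sp; have gi := smooth_is_pderiv i sg Sp.
by rewrite (pderiv_is_derive (is_pderivM fi gi)); ring.
Qed.

Lemma vactZ S A c f p : smooth S f -> S p ->
  vact A (fun q => c * f q) p = c * vact A f p.
Proof.
by move=> sf Sp; rewrite (vactM A (smooth_cst S c) sf Sp) vact_cst mulr0 addr0.
Qed.

Lemma vact_expR S A f p : smooth S f -> S p ->
  vact A (fun q => expR (f q)) p = expR (f p) * vact A f p.
Proof.
move=> sf Sp; have [B [ O [fB SO sf']]] := sf.
have Op := SO _ Sp; have [[oO _] hf Cf] := sf'.
have se : smooth_on B O (fun q => expR (f q)).
  split; [by case: sf'| |by move=> n; exact: Cn_expR oO (Cf n)].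
  by move=> q q' qq Oq Oq'; rewrite (hf q q').
rewrite !(vactE _ fB _ Op)// mulr_sumr; apply: eq_bigr => i _.
have fi := smooth_is_pderiv i sf Sp.
by rewrite (pderiv_is_derive (is_pderiv_expR fi)); ring.
Qed.

Lemma vact_sum S (T : eqType) (s : seq T) (F : T -> pt R I -> R) A p :
  (forall x, smooth S (F x)) -> S p ->
  vact A (fun q => \sum_(x <- s) F x q) p = \sum_(x <- s) vact A (F x) p.
Proof.
move=> sF Sp; elim: s => [|x s IHs].
  by under eq_fun do rewrite big_nil; rewrite vact_cst big_nil.
under eq_fun do rewrite big_cons; rewrite big_cons -IHs (vactD _ (sF x) _ Sp)//.
by apply: smooth_sum => y _.
Qed.

Lemma smooth_vact S A f : (forall i, smooth S (A i)) -> smooth S f ->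
  smooth S (vact A f).
Proof.
move=> sA sf; have [B [ O [fB SO sf']]] := sf.
apply: (@near_eq_smooth R I B O S
    (fun p => \sum_(i <- fset_set B) A i p * pderiv i f p)) => //.
- by case: sf'.
- by move=> p Op; rewrite (vactE _ fB sf' Op).
- by apply: smooth_sum => i _; apply: smoothM => //; exact: smooth_pderiv.
Qed.

Definition bracket A C : vfield R I :=
  fun i p => vact A (C i) p - vact C (A i) p.

Lemma vact_vact S B O A C f p : finite_set B -> smooth_on B O f -> S `<=` O ->
  (forall i, smooth S (C i)) -> S p ->
  vact A (vact C f) p =
    \sum_(i <- fset_set B) vact A (C i) p * pderiv i f p +
    \sum_(i <- fset_set B) \sum_(j <- fset_set B)
      C i p * A j p * pderiv j (pderiv i f) p.
Proof.
move=> fB sf SO sC Sp; have Op := SO _ Sp; have [[oO _] _ _] := sf.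
rewrite (near_eq_vact A oO Op (fun q Oq => vactE C fB sf Oq)).
have sdf i : smooth S (pderiv i f) by exists B, O; split=> //; exact: smooth_on_pderiv.
rewrite (@vact_sum S)// => [|i]; last exact: smoothM.
rewrite -big_split/=; apply: eq_bigr => i _.
rewrite (vactM A (sC i) (sdf i) Sp) (vactE _ fB (smooth_on_pderiv i sf) Op).
rewrite mulr_sumr [LHS]addrC; congr (_ + _); first by rewrite mulrC.
by apply: eq_bigr => j _; rewrite mulrA.
Qed.

(** The second-order terms of the two compositions agree, by the symmetry of second derivatives and
    an exchange of the sums. Only the derivatives of the components remain. *)
Lemma vact_bracket S A C f p : (forall i, smooth S (A i)) ->
  (forall i, smooth S (C i)) -> smooth S f -> S p ->
  vact A (vact C f) p - vact C (vact A f) p = vact (bracket A C) f p.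
Proof.
move=> sA sC sf Sp; have [B [ O [fB SO sf']]] := sf; have Op := SO _ Sp.
have sym : \sum_(i <- fset_set B) \sum_(j <- fset_set B)
      C i p * A j p * pderiv j (pderiv i f) p =
    \sum_(i <- fset_set B) \sum_(j <- fset_set B)
      A i p * C j p * pderiv j (pderiv i f) p.
  rewrite exchange_big/=; apply: eq_bigr => i _; apply: eq_bigr => j _.
  by rewrite (smooth_pderivC i j sf Sp) [C j p * _]mulrC.
rewrite (vact_vact A fB sf' SO sC Sp) (vact_vact C fB sf' SO sA Sp) sym.
rewrite (vactE _ fB sf' Op) opprD addrACA subrr addr0 -sumrB.
by apply: eq_bigr => i _; rewrite -mulrBl.
Qed.

End Vact.

(** * A primitive in the direction of one coordinate *)

Section Primitive.
Variables (R : realType) (I : choiceType) (w : I) (w0 : R).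
Local Notation J := (I + 'I_1)%type.
Implicit Types (q : pt R I) (x : pt R J) (t : R) (O : set (pt R I)).

(** The coordinate [w] is contracted towards [w0] with the extra coordinate as ratio: at ratio 0 it
    is [w0], at ratio 1 it is unchanged. *)
Definition homothety x : pt R I :=
  dfwith (fun i => x (inl i)) w (w0 + x (inr ord0) * (x (inl w) - w0)).

Lemma homothetyE x i :
  homothety x i = if w == i then w0 + x (inr ord0) * (x (inl w) - w0) else x (inl i).
Proof. by rewrite /homothety dfwithE. Qed.

Lemma continuous_homothety : continuous homothety.
Proof.
move=> x; apply: (@continuous_ptP R I _ homothety x) => i.
have c (j : J) : (fun y : pt R J => y j) @ x --> x j by exact: (@continuous_coord R J j x).
have -> : homothety ^~ i = (fun y => if w == i
    then w0 + y (inr ord0) * (y (inl w) - w0) else y (inl i)).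
  by apply/funext => y; rewrite homothetyE.
rewrite homothetyE; case: eqP => _; last exact: c.
have c0 : (fun _ : pt R J => w0) @ x --> w0 by exact: (@cst_continuous (pt R J) R w0 x).
exact: cvgD c0 (cvgM (c _) (cvgB (c _) c0)).
Qed.

Lemma homothety_inr x (j : 'I_1) t : homothety (dfwith x (inr j) t) =
  dfwith (homothety x) w (homothety x w + (x (inl w) - w0) * (t - x (inr j))).
Proof.
rewrite (ord1 j); apply/funext => i; rewrite homothetyE dfwithE !homothetyE eqxx.
rewrite !dfwithE !eqxx /=; case: eqP => // _; ring.
Qed.

Lemma homothety_inl_w x t : homothety (dfwith x (inl w) t) =
  dfwith (homothety x) w (homothety x w + x (inr ord0) * (t - x (inl w))).
Proof.
apply/funext => i; rewrite homothetyE dfwithE !homothetyE eqxx.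
rewrite !dfwithE !eqxx /=; case: eqP => [_|wi]; first by ring.
by rewrite (_ : (inl w == inl i :> J) = false)//; apply/eqP => -[].
Qed.

Lemma homothety_inl x i t : i != w -> homothety (dfwith x (inl i) t) =
  dfwith (homothety x) i (homothety x i + 1 * (t - x (inl i))).
Proof.
move=> iw; have wi : (w == i) = false by rewrite eq_sym; apply/negbTE.
apply/funext => k; rewrite homothetyE dfwithE !homothetyE wi.
rewrite !dfwithE /= [inl i == inl w]/eq_op/= (negbTE iw).
rewrite [inl i == inl k]/eq_op/=; case: eqP => [<-|wk].
  by rewrite (negbTE iw).
by case: eqP => // _; ring.
Qed.

Lemma Cn_homothety n O g : open O -> Cn n O g ->
  Cn n (homothety @^-1` O) (g \o homothety).
Proof.
move=> oO; apply: Cn_comp => //.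
- by apply: open_comp => // x _; exact: continuous_homothety.
- by move=> x _; exact: continuous_homothety.
have oP : open (homothety @^-1` O).
  by apply: open_comp => // x _; exact: continuous_homothety.
case=> [i|j]; last first.
  exists w, (fun x => x (inl w) + - w0) => [k|x t]; last exact: homothety_inr.
  by apply: CnD => //; [exact: Cn_coord|exact: Cn_cst].
have [->|iw] := eqVneq i w.
  exists w, (fun x => x (inr ord0)) => [k|x t]; last exact: homothety_inl_w.
  exact: Cn_coord.
exists i, (fun=> 1) => [k|x t]; last exact: homothety_inl.
exact: Cn_cst.
Qed.

Lemma homothety_snoc q t i :
  homothety (snoc q t) i = if w == i then w0 + t * (q w - w0) else q i.
Proof. by rewrite homothetyE. Qed.

Lemma snoc_dfwith_inr q s t : dfwith (snoc q s) (inr ord0) t = snoc q t.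
Proof. by apply/funext => -[i|j]; rewrite dfwithE//= (ord1 j) eqxx. Qed.

(** The primitive is (w - w0) times the integral over [0, 1] of g at w0 + t (w - w0). The set [O']
    consists of the points whose segment to w = w0 along the coordinate [w] lies in [O]. *)
Lemma smooth_primitive (B : set I) O (g : pt R I -> R) : smooth_on B O g ->
  let O' := tube01 (homothety @^-1` O) in
  exists V : pt R I -> R, [/\ smooth_on (B `|` [set w]) O' V,
    forall q, O' q -> pderiv w V q = g q &
    forall q, q w = w0 -> V q = 0].
Proof.
move=> sg O'; have [[oO hO] hg Cg] := sg.
have oP : open (homothety @^-1` O).
  by apply: open_comp => // x _; exact: continuous_homothety.
have oO' : open O' by exact: open_tube01.
pose G := g \o homothety.
have CG n : Cn n (homothety @^-1` O) G by exact: Cn_homothety.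
have CV n : Cn n O' (fun q => (q w + - w0) * int_last G q).
  apply: CnM => //; last exact: Cn_int_last.
  by apply: CnD => //; [exact: Cn_coord|exact: Cn_cst].
have agree q q' t : (forall i, (B `|` [set w]) i -> q i = q' i) ->
    forall i, B i -> homothety (snoc q t) i = homothety (snoc q' t) i.
  move=> qq i Bi; rewrite !homothety_snoc.
  by rewrite (qq w) ?(qq i)//; [left|right].
exists (fun q => (q w + - w0) * int_last G q); split.
- split=> //.
    split=> // q q' qq Oq t t01; apply: hO (Oq t t01).
    by move=> i Bi; exact: agree.
  move=> q q' qq Oq Oq'; rewrite (qq w); last by right.
  congr (_ * _); apply: eq_Rintegral => t; rewrite inE/= in_itv/= => t01.
  by apply: hg; [move=> i Bi; exact: agree|exact: Oq|exact: Oq'].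
- move=> q Oq.
  have d1 : is_pderiv w (fun q => q w + - w0) q ((w == w)%:R + 0).
    by apply: is_pderivD; [exact: is_pderiv_coord|exact: is_pderiv_cst].
  have d2 := is_pderiv_int_last w oP (CG 1) Oq.
  rewrite (pderiv_is_derive (is_pderivM d1 d2)) eqxx addr0 mulr1.
  have cG : cont01 (fun t => G (snoc q t)) by apply: (cont01_snoc _ Oq); have [] := CG 0.
  have cdG : cont01 (fun t => pderiv (inl w) G (snoc q t)).
    by apply: (cont01_snoc _ Oq); have [] := Cn_pderiv (inl w) (CG 1).
  have cdG' : cont01 (fun t => (q w + - w0) * pderiv (inl w) G (snoc q t)).
    by move=> t t01; apply: continuousM; [exact: cst_continuous|exact: cdG].
  rewrite /int_last -int01Z// -int01D//.
  (* The product rule leaves the integrand g + t (w - w0) g', which is the derivative of t g(w0 + t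
     (w - w0)) in t. Its increment from 0 to 1 is g at [q]. *)
  pose F t := (fun x => x (inr ord0) * G x) (snoc q t).
  have -> : int01 (fun t => (q w + - w0) * pderiv (inl w) G (snoc q t) + G (snoc q t)) =
      F 1 - F 0; last first.
    rewrite /F /= mul1r mul0r subr0; congr g; apply/funext => i.
    by rewrite homothety_snoc; case: eqP => // <-; ring.
  apply: int01_FTC2; first by move=> t t01; apply: continuousD; [exact: cdG'|exact: cG].
  move=> t t01; have Ot : O (homothety (snoc q t)) by exact: Oq.
  have dg := Cn_is_pderiv w (Cg 1) Ot.
  have e1 := is_pderiv_comp (homothety_inr (snoc q t) ord0) dg.
  have e2 := is_pderiv_comp (homothety_inl_w (snoc q t)) dg.
  have e3 := is_pderivM (is_pderiv_coord (inr ord0) (inr ord0) (snoc q t)) e1.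
  move: e3; rewrite /is_pderiv eqxx mulr1 /=.
  under eq_fun do rewrite snoc_dfwith_inr.
  rewrite (pderiv_is_derive e2) /=.
  congr (is_derive _ _ _ _); rewrite /G /=; ring.
- by move=> q qw; rewrite qw subrr mul0r.
Qed.

End Primitive.

(** * Coverings of rank one *)

Section RankOne.
(* [i0] is any coordinate: [smooth_comp] asks for one, which is moved with speed
   0, also along the fibre. *)
Variables (R : realType) (E : diffiety R) (i0 : coordT E).
Local Notation TE := (tot_coord E 1).
Local Notation w := (inr ord0 : TE).
Implicit Types (p : pt R (coordT E)) (q : pt R TE) (t : R).

Definition section t p : pt R TE := snoc p t.

Lemma section_proj q : section (q w) (proj_base q) = q.
Proof. by apply/funext => -[i//|j]; rewrite (ord1 j). Qed.

Lemma dfwith_fibre q t : dfwith q w t = section t (proj_base q).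
Proof. by apply/funext => -[i|j]; rewrite dfwithE//= (ord1 j) eqxx. Qed.

Lemma pderiv_inl (f : pt R TE -> R) i q :
  pderiv (inl i) f q = pderiv i (f \o section (q w)) (proj_base q).
Proof.
rewrite /pderiv; congr (derive1 _ _); apply/funext => t /=.
congr f; rewrite -{1}(section_proj q); exact/esym/snoc_dfwith.
Qed.

Lemma pderiv_fibre_proj (f : pt R (coordT E) -> R) q (j : 'I_1) :
  pderiv (inr j : TE) (f \o @proj_base R E 1) q = 0.
Proof.
apply: pderiv_is_derive; have -> : (fun t => (f \o @proj_base R E 1) (dfwith q (inr j) t))
   = cst (f (proj_base q)); last exact: is_derive_cst.
by apply/funext => t /=; congr f; apply/funext => i; rewrite /proj_base dfwithE.
Qed.

Lemma smooth_proj (S : set (pt R (coordT E))) (S' : set (pt R TE)) f :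
  (forall q, S' q -> S (proj_base q)) ->
  smooth S f -> smooth S' (f \o @proj_base R E 1).
Proof.
apply: (@smooth_comp R (coordT E) TE _ (fun i => [set (inl i : TE)])).
- move=> q; apply: (@continuous_ptP R _ _ (@proj_base R E 1) q) => i.
  exact: (@continuous_coord R TE (inl i) q).
- by move=> i; exact: finite_set1.
- by move=> i q q' h; exact: (h (inl i)).
- case=> [i|j].
    exists i, (fun=> 1) => [k|q t]; first by apply: Cn_cst; exact: openT.
    apply/funext => k; rewrite /proj_base !dfwithE [inl i == _]/eq_op/=.
    by case: eqP => // _; ring.
  exists i0, (fun=> 0) => [k|q t]; first by apply: Cn_cst; exact: openT.
  rewrite mul0r addr0 dfwith_id.
  by apply/funext => k; rewrite /proj_base dfwithE.
Qed.

Lemma smooth_section (S : set (pt R (coordT E))) (S' : set (pt R TE)) f t :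
  (forall p, S p -> S' (section t p)) -> smooth S' f -> smooth S (f \o section t).
Proof.
apply: (@smooth_comp R TE (coordT E) _
  (fun c : TE => if c is inl i then [set i] else set0)).
- move=> p; apply: (@continuous_ptP R _ _ (section t) p) => -[i|j].
    exact: (@continuous_coord R (coordT E) i p).
  exact: (@cst_continuous _ R t p).
- by case=> [i|j]; [exact: finite_set1|exact: finite_set0].
- by case=> [i|j] p p' // h; exact: (h i).
- move=> i; exists (inl i), (fun=> 1) => [k|p s]; first by apply: Cn_cst; exact: openT.
  rewrite /section snoc_dfwith; congr (dfwith _ _ _); rewrite /=; ring.
Qed.

Lemma vact_fibre (a : pt R TE -> R) f q :
  vact (fun c q => if c is inr _ then a q else 0) f q = a q * pderiv w f q.
Proof.
rewrite /vact (fsbigTE [fset w]%fset) ?big_seq_fset1// => -[i|j] //.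
  by rewrite mul0r.
by rewrite inE (ord1 j) eqxx.
Qed.

Lemma vact_base (A : vfield R (coordT E)) f q :
  vact (lift_vfield A (fun=> fun=> 0)) f q =
  vact A (f \o section (q w)) (proj_base q).
Proof.
rewrite /vact; set F := (X in \sum_(c \in _) X c).
have -> : \sum_(c \in [set: TE]) F c = \sum_(c \in range (inl : coordT E -> TE)) F c.
  apply/esym/fsbig_widen => // -[i|j] [_ /= h]; last by rewrite /F mul0r.
  by exfalso; apply: h; exists i.
rewrite fsbig_image; last by move=> x y _ _ [].
by apply: eq_fsbigr => i _; rewrite /F /= pderiv_inl.
Qed.

(** Splits a total derivative into the base derivative along a slice of constant w and a fibre term;
    this is how forms restricted to a slice are differentiated on the base. *)
Lemma vact_lift (S : set (pt R TE)) (A : vfield R (coordT E)) X f q :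
  smooth S f -> S q ->
  vact (lift_vfield A (fun=> X)) f q =
  vact A (f \o section (q w)) (proj_base q) + X q * pderiv w f q.
Proof.
move=> [B [ O [fB SO sf]]] Sq; rewrite -vact_base -vact_fibre.
rewrite !(vactE _ fB sf (SO _ Sq)) -big_split/=; apply: eq_bigr => -[i|j] _ /=.
  by rewrite mul0r addr0.
by rewrite mul0r add0r.
Qed.

Lemma vact_proj (S : set (pt R (coordT E))) (A : vfield R (coordT E)) X f q :
  smooth S f -> S (proj_base q) ->
  vact (lift_vfield A (fun=> X)) (f \o @proj_base R E 1) q = vact A f (proj_base q).
Proof.
move=> sf Sq; rewrite (@vact_lift (@proj_base R E 1 @^-1` S))//; last first.
  exact: smooth_proj sf.
by rewrite pderiv_fibre_proj mulr0 addr0.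
Qed.

(** The logarithm is not smooth across [q w = 0], so the sum is evaluated directly: only the fibre
    coordinate contributes. *)
Lemma vact_ln (A : vfield R (coordT E)) (a : pt R (coordT E) -> R) q : 0 < q w ->
  vact (lift_vfield A (fun=> fun q => a (proj_base q) * q w)) (fun q => ln (q w)) q =
  a (proj_base q).
Proof.
move=> q0; have d : is_pderiv w (fun q : pt R TE => ln (q w)) q (q w)^-1.
  rewrite /is_pderiv; under eq_fun do rewrite dfwithin.
  exact: is_derive1_ln.
rewrite /vact (fsbigTE [fset w]%fset) => [|[i|j]].
- by rewrite big_seq_fset1 /= (pderiv_is_derive d) mulfK// gt_eqF.
- move=> _; rewrite pderiv_inl; set h := _ \o _.
  have -> : h = (fun=> ln (q w)) by [].
  by rewrite (pderiv_is_derive (is_pderiv_cst _ _ _)) mulr0.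
- by rewrite inE (ord1 j) eqxx.
Qed.

End RankOne.

(** * Total derivatives of a covering and the fibre direction *)

Section Covering.
Variables (R : realType) (E : diffiety R) (i0 : coordT E).
Variables (W : set (pt R 'I_1)) (X Y : pt R (tot_coord E 1) -> R).
Local Notation TE := (tot_coord E 1).
Local Notation w := (inr ord0 : TE).
Let Et := total_space W (fun=> X) (fun=> Y).
Implicit Types (p : pt R (coordT E)) (q : pt R TE) (t : R).

Hypothesis smooth_Dx : forall i, smooth (locus E) (Dx E i).
Hypothesis smooth_Dy : forall i, smooth (locus E) (Dy E i).
Hypothesis oW : open W.
Hypothesis smooth_X : smooth (locus Et) X.
Hypothesis smooth_Y : smooth (locus Et) Y.

Lemma locus_section p t : locus E p -> W (fun=> t) -> locus Et (section t p).
Proof. by []. Qed.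

Lemma locusP q : locus Et q <-> locus E (proj_base q) /\ W (fun=> q w).
Proof.
suff -> : (fun=> q w) = proj_fibre q by [].
by apply/funext => j; rewrite (ord1 j).
Qed.

Lemma near_fibre t : W (fun=> t) -> \forall s \near t, W (fun=> s).
Proof.
move=> Wt.
have c : (fun s => (fun=> s) : pt R 'I_1) @ t --> ((fun=> t) : pt R 'I_1).
  by apply: (@continuous_ptP R _ _ (fun s => (fun=> s) : pt R 'I_1) t) => i; exact: cvg_id.
by apply: c; exact: open_nbhs_nbhs.
Qed.

(** Since [W] is open, a short piece of the fibre line through [q] stays in the locus, so an
    identity that holds only there may be differentiated in w. *)
Lemma pderiv_fibre_locus (f g : pt R TE -> R) q : locus Et q ->
  (forall q, locus Et q -> f q = g q) -> pderiv w f q = pderiv w g q.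
Proof.
move=> /locusP[Eq Wq] fg; rewrite /pderiv !derive1E; apply: near_eq_derive.
apply: filterS (near_fibre Wq) => t Wt; apply: fg.
by rewrite dfwith_fibre; exact: locus_section.
Qed.

Lemma smooth_lift (A : vfield R (coordT E)) (Z : pt R TE -> R) c :
  (forall i, smooth (locus E) (A i)) -> smooth (locus Et) Z ->
  smooth (locus Et) (lift_vfield A (fun=> Z) c).
Proof.
move=> sA sZ; case: c => [i|j] //=.
by apply: (smooth_proj i0 _ (sA i)) => q [].
Qed.

(** This is the commutator [d/dw, A + Z d/dw] = (dZ/dw) d/dw, the components of [A] being constant
    along the fibre. *)
Lemma pderiv_fibre_vact (A : vfield R (coordT E)) (Z f : pt R TE -> R) q :
  (forall i, smooth (locus E) (A i)) -> smooth (locus Et) Z ->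
  smooth (locus Et) f -> locus Et q ->
  pderiv w (vact (lift_vfield A (fun=> Z)) f) q =
  vact (lift_vfield A (fun=> Z)) (pderiv w f) q + pderiv w Z q * pderiv w f q.
Proof.
move=> sA sZ sf Eq.
pose dw : vfield R TE := fun c q => if c is inr _ then 1 else 0.
have dwE (g : pt R TE -> R) : vact dw g = pderiv w g.
  by apply/funext => q'; rewrite (vact_fibre (fun=> 1)) mul1r.
have sdw c : smooth (locus Et) (dw c) by case: c => ?; exact: smooth_cst.
have sL c := smooth_lift c sA sZ.
have := vact_bracket sdw sL sf Eq; rewrite !dwE => /eqP.
rewrite subr_eq addrC => /eqP ->; congr (_ + _).
rewrite -vact_fibre; apply: eq_fsbigr => c _; congr (_ * _).
rewrite /bracket dwE; case: c => [i|j] /=; rewrite vact_cst subr0.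
  exact: pderiv_fibre_proj.
by [].
Qed.

(** The commutator of the total derivatives is the vector field [bracket], so it vanishes as soon as
    its components do. *)
Lemma commuting_total_space : (forall c q, locus Et q ->
    vact (Dx Et) (Dy Et c) q = vact (Dy Et) (Dx Et c) q) -> commuting Et.
Proof.
move=> H f sf q Eq; apply/eqP; rewrite -subr_eq0; apply/eqP.
have sx c : smooth (locus Et) (Dx Et c) := smooth_lift c smooth_Dx smooth_X.
have sy c : smooth (locus Et) (Dy Et c) := smooth_lift c smooth_Dy smooth_Y.
rewrite (vact_bracket sx sy sf Eq); apply: fsbig1 => c _.
by rewrite /bracket H// subrr mul0r.
Qed.

Lemma fibre_constant (h : pt R TE -> R) (t : R) q :
  smooth (locus Et) h -> (forall q, locus Et q -> pderiv w h q = 0) ->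
  (forall u : R, 0 <= u <= 1 -> W (fun=> t + u * (q w - t))) ->
  locus E (proj_base q) -> h q = h (section t (proj_base q)).
Proof.
move=> [B [ O [fB SO [_ _ Ch]]]] dh Wt Eq.
have Et_u u : 0 <= u <= 1 -> locus Et (dfwith q w (t + u * (q w - t))).
  by move=> /Wt Wu; rewrite dfwith_fibre; exact: locus_section.
have [u u01|u u01] := @MVT_between R (fun s => h (dfwith q w s))
    (fun s => pderiv w h (dfwith q w s)) t (q w).
  by apply: is_derive_line (Ch 1) _; apply: SO; exact: Et_u.
rewrite dh ?mul0r; last exact: Et_u.
by rewrite dfwith_id dfwith_fibre => /eqP; rewrite subr_eq0 => /eqP.
Qed.

Hypothesis comm : commuting Et.

Lemma commuting_coord c q : locus Et q ->
  vact (Dx Et) (Dy Et c) q = vact (Dy Et) (Dx Et c) q.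
Proof.
move=> Eq; have := comm (smooth_coord (locus Et) c) Eq.
have e (A : vfield R TE) : vact A (fun q => q c) = A c.
  by apply/funext => q'; exact: vact_coord.
by rewrite !e.
Qed.

(** Differentiate Dx Y = Dy X in w: the two commutator terms are both the product of [pderiv w X]
    and [pderiv w Y], and cancel. *)
Lemma closed_fibre_derivative : @closed_form R Et (pderiv w X, pderiv w Y).
Proof.
split; [exact: smooth_pderiv|exact: smooth_pderiv|move=> q Eq /=].
have := pderiv_fibre_locus Eq (commuting_coord w).
rewrite (pderiv_fibre_vact smooth_Dx smooth_X smooth_Y Eq).
rewrite (pderiv_fibre_vact smooth_Dy smooth_Y smooth_X Eq).
by rewrite [pderiv w Y q * _]mulrC => /addIr.
Qed.

Section Nonabelian.
Variables (w0 : R) (p0 : pt R (coordT E)).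
Hypothesis Ep0 : locus E p0.
Hypothesis Ww0 : W (fun=> w0).
Hypothesis W_convex : forall a b u : R, W (fun=> a) -> W (fun=> b) ->
  0 <= u <= 1 -> W (fun=> a + u * (b - a)).
Hypothesis irr : diff_connected Et.

Lemma abelian_of_exact :
  @exact_form R Et (pderiv w X, pderiv w Y) -> abelian_covering W (fun=> X) (fun=> Y).
Proof.
move=> [f sf ff].
pose g q := expR (-1 * f q).
have smf : smooth (locus Et) (fun q => -1 * f q) by apply: smoothM => //; exact: smooth_cst.
have sg : smooth (locus Et) g by exact: smooth_expR.
have [B [ O [fB SO sgO]]] := sg.
have [V [sV dV V0]] := smooth_primitive w w0 sgO.
set O' := tube01 _ in sV dV.
have SO' : locus Et `<=` O'.
  move=> q /locusP[Eq Wq] t t01; apply: SO.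
  have -> : homothety w w0 (snoc q t) = section (w0 + t * (q w - w0)) (proj_base q).
    rewrite -dfwith_fibre; apply/funext => c.
    by rewrite homothety_snoc dfwithE.
  by apply: locus_section => //; exact: W_convex.
have [[oO' _] _ _] := sV.
have {}sV : smooth (locus Et) V.
  by exists (B `|` [set w]), O'; split=> //; rewrite finite_setU; split.
have dxg q : locus Et q -> vact (Dx Et) g q = - (g q * pderiv w X q).
  move=> Eq; rewrite (vact_expR _ smf Eq) (vactZ _ _ sf Eq).
  by have [<- _] := ff q Eq; rewrite mulrCA [LHS]mulN1r.
have dyg q : locus Et q -> vact (Dy Et) g q = - (g q * pderiv w Y q).
  move=> Eq; rewrite (vact_expR _ smf Eq) (vactZ _ _ sf Eq).
  by have [_ <-] := ff q Eq; rewrite mulrCA [LHS]mulN1r.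
(* Treats both total derivatives at once. The derivative of [V] is constant along the fibre, hence
   may be read off at w = w0; there [V] vanishes on the whole slice and only the fibre term [Z * g]
   survives. *)
have basic (A : vfield R (coordT E)) (Z : pt R TE -> R) :
    (forall i, smooth (locus E) (A i)) -> smooth (locus Et) Z ->
    (forall q, locus Et q ->
      vact (lift_vfield A (fun=> Z)) g q = - (g q * pderiv w Z q)) ->
    forall q, locus Et q -> vact (lift_vfield A (fun=> Z)) V q =
      Z (section w0 (proj_base q)) * g (section w0 (proj_base q)).
  move=> sA sZ dg q Eq; have [Ep Wq] := (locusP _).1 Eq.
  rewrite (@fibre_constant _ w0)//.
  - have Es : locus Et (section w0 (proj_base q)) by exact: locus_section.
    rewrite (vact_lift _ _ sV Es) dV; last exact: SO'.
    have -> : V \o section w0 = fun=> 0 by apply/funext => p; exact: V0.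
    by rewrite vact_cst add0r.
  - by apply: smooth_vact => // c; exact: smooth_lift.
  - move=> q' Eq'; rewrite (pderiv_fibre_vact sA sZ sV Eq').
    (* The equality of [pderiv w V] and [g] holds on the open set [O'], not just on the locus, so
       the lifted field may be applied to it. *)
    rewrite (near_eq_vact _ oO' (SO' _ Eq') dV) (dg _ Eq') (dV _ (SO' _ Eq')).
    by rewrite [pderiv w Z q' * _]mulrC addNr.
  - by move=> u u01; exact: W_convex.
have dxV := basic _ _ smooth_Dx smooth_X dxg.
have dyV := basic _ _ smooth_Dy smooth_Y dyg.
pose kX q := X q * g q; pose kY q := Y q * g q.
have skX : smooth (locus Et) kX by exact: smoothM.
have skY : smooth (locus Et) kY by exact: smoothM.
pose om : hform E := (kX \o section w0, kY \o section w0).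
have om_closed : closed_form om.
  split=> /=.
  - by apply: smooth_section skX => p Ep; exact: locus_section.
  - by apply: smooth_section skY => p Ep; exact: locus_section.
  - move=> p Ep; have Eq : locus Et (section w0 p) by exact: locus_section.
    set q := section w0 p in Eq *.
    have gw := smooth_is_pderiv w sg Eq.
    have Xw := smooth_is_pderiv w smooth_X Eq.
    have Yw := smooth_is_pderiv w smooth_Y Eq.
    (* A base derivative on the slice is the total derivative minus its fibre term. After expansion
       both sides contain X Y times the fibre derivative of [g], and the terms with [pderiv w X] and
       [pderiv w Y] match crosswise. *)
    have eX : vact (Dx E) (kY \o section w0) p = vact (Dx Et) kY q - X q * pderiv w kY q.
      by rewrite (vact_lift (Dx E) X skY Eq) addrK.
    have eY : vact (Dy E) (kX \o section w0) p = vact (Dy Et) kX q - Y q * pderiv w kX q.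
      by rewrite (vact_lift (Dy E) Y skX Eq) addrK.
    rewrite eX eY (vactM _ smooth_Y sg Eq) (vactM _ smooth_X sg Eq).
    rewrite (commuting_coord w Eq : vact _ Y q = vact _ X q) (dxg _ Eq) (dyg _ Eq).
    rewrite (pderiv_is_derive (is_pderivM Yw gw)) (pderiv_is_derive (is_pderivM Xw gw)).
    ring.
exists (fun=> om); split=> //.
- move=> c [h sh hh] j; rewrite (ord1 j).
  pose k q := c ord0 * V q + -1 * (h \o @proj_base R E 1) q.
  have shp : smooth (locus Et) (h \o @proj_base R E 1).
    by apply: (smooth_proj i0 _ sh) => q [].
  have scV : smooth (locus Et) (fun q => c ord0 * V q).
    by apply: smoothM => //; exact: smooth_cst.
  have smh : smooth (locus Et) (fun q => -1 * (h \o @proj_base R E 1) q).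
    by apply: smoothM => //; exact: smooth_cst.
  have sk : smooth (locus Et) k by exact: smoothD.
  have [q Eq|C kC] := irr sk.
    have [Ep Wq] := (locusP _).1 Eq; have := hh _ Ep.
    rewrite /lin_comb/= !big_ord1/= => -[h1 h2].
    split; rewrite (vactD _ scV smh Eq) (vactZ _ _ sV Eq) (vactZ _ _ shp Eq).
      by rewrite (vact_proj i0 _ _ sh Ep) dxV// -h1 /kX; ring.
    by rewrite (vact_proj i0 _ _ sh Ep) dyV// -h2 /kY; ring.
  have Eq0 : locus Et (section w0 p0) by exact: locus_section.
  (* Differentiating the constant first integral in w at one point kills the pulled back [h] and
     leaves c e^{-f} = 0. *)
  have := pderiv_fibre_locus Eq0 kC.
  rewrite (pderiv_is_derive (is_pderiv_cst _ _ _)).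
  have dc x := is_pderiv_cst w x (section w0 p0).
  have dv := smooth_is_pderiv w sV Eq0; have dh := smooth_is_pderiv w shp Eq0.
  rewrite (pderiv_is_derive (is_pderivD (is_pderivM (dc _) dv) (is_pderivM (dc _) dh))).
  rewrite pderiv_fibre_proj !mulr0 !addr0 dV; last exact: SO'.
  have g0 : g (section w0 p0) != 0 by rewrite gt_eqF// expR_gt0.
  by move/eqP; rewrite mulf_eq0 (negbTE g0) orbF => /eqP.
- by move=> _; exists V => // q Eq; split; [rewrite dxV|rewrite dyV].
Qed.

End Nonabelian.

End Covering.

(** * Connectedness of the fibre and the linear covering *)

Section LocallyConstant.
Variables (R : realType) (I : choiceType).
Implicit Types (p q : pt R I) (f : pt R I -> R) (O : set (pt R I)).

Lemma is_pderiv_locally_constant f p i :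
  (\forall q \near p, f q = f p) -> is_pderiv i f p 0.
Proof.
move=> fp; apply: (@near_eq_is_derive R R R (cst (f p))).
have := @continuous_line R I p i (p i); rewrite /continuous_at dfwith_id => h.
have nf : \forall t \near p i, f (dfwith p i t) = f p by exact: h fp.
by apply: filterS nf => t ->.
Qed.

Lemma Cn_locally_constant n O f : open O ->
  (forall p, O p -> \forall q \near p, f q = f p) -> Cn n O f.
Proof.
move=> oO lf; have cf : {in O, continuous f}.
  move=> p; rewrite inE => /lf fp.
  suff : f @ nbhs p --> f p by [].
  have e : \forall q \near p, cst (f p) q = f q by apply: filterS fp => q.
  exact: cvg_trans (near_eq_cvg e) (@cst_continuous (pt R I) R (f p) p).
case: n => [//|n]; apply: CnS => // i; exists (fun=> 0); split; last exact: Cn_cst.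
by move=> p /lf; exact: is_pderiv_locally_constant.
Qed.

Definition coord_step i (s : R) : pt R I -> R := fun q => if s < q i then 1 else 0.

Lemma near_coord_step i s p : p i != s ->
  \forall q \near p, coord_step i s q = coord_step i s p.
Proof.
rewrite neq_lt => /orP[ps|sp].
  have ns : \forall t \near p i, t < s by exact: lt_nbhsl.
  have nq : \forall q \near p, q i < s by exact: (@continuous_coord R I i p _ ns).
  apply: (@filterS _ (nbhs p) _ [set q | q i < s] _ _ nq) => q qs.
  by rewrite /coord_step (lt_gtF qs) (lt_gtF ps).
have ns : \forall t \near p i, s < t by exact: lt_nbhsr.
have nq : \forall q \near p, s < q i by exact: (@continuous_coord R I i p _ ns).
apply: (@filterS _ (nbhs p) _ [set q | s < q i] _ _ nq) => q qs.
by rewrite /coord_step sp qs.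
Qed.

Lemma smooth_on_coord_step i s :
  smooth_on [set i] [set q | q i != s] (coord_step i s).
Proof.
have oO : open [set q : pt R I | q i != s].
  have -> : [set q : pt R I | q i != s] = (fun q : pt R I => q i) @^-1` (~` [set s]).
    by apply/seteqP; split=> q /= /eqP.
  apply: open_comp => [q _|]; first exact: (@continuous_coord R I i q).
  by rewrite openC; exact: closed_eq.
split.
- by split=> // p q pq; rewrite /= pq.
- by move=> p q pq _ _; rewrite /coord_step pq.
- by move=> n; apply: Cn_locally_constant => // p; exact: near_coord_step.
Qed.

End LocallyConstant.

Section FibreConvex.
Variables (R : realType) (E : diffiety R).
Variables (W : set (pt R 'I_1)) (X Y : pt R (tot_coord E 1) -> R).
Local Notation w := (inr ord0 : tot_coord E 1).
Let Et := total_space W (fun=> X) (fun=> Y).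

(* Otherwise the indicator function of one side of a gap in the fibre would be a
   nonconstant first integral. *)
Lemma fibre_convex p0 : locus E p0 -> diff_connected Et ->
  forall a b u : R, W (fun=> a) -> W (fun=> b) ->
  0 <= u <= 1 -> W (fun=> a + u * (b - a)).
Proof.
move=> Ep0 irr a b u Wa Wb u01; set s := a + u * (b - a); apply: contrapT => Ws.
pose f := coord_step w s; pose O := [set q : pt R (tot_coord E 1) | q w != s].
have SO : locus Et `<=` O.
  move=> q [_ Wq]; apply/eqP => qs; apply: Ws; rewrite -qs.
  by congr W: Wq; apply/funext => j; rewrite (ord1 j).
have sf : smooth (locus Et) f.
  by exists [set w], O; split=> //; exact: smooth_on_coord_step.
have [q Eq|C fC] := irr f sf.
  have f0 (A : vfield R (tot_coord E 1)) : vact A f q = 0.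
    apply: fsbig1 => c _.
    by rewrite (pderiv_is_derive (is_pderiv_locally_constant c (near_coord_step (SO _ Eq)))) mulr0.
  by rewrite !f0.
have fa := fC (section a p0) (conj Ep0 Wa); have fb := fC (section b p0) (conj Ep0 Wb).
have a_s : a != s by apply/eqP => e; apply: Ws; rewrite -e.
have bs : b != s by apply/eqP => e; apply: Ws; rewrite -e.
(* As [s] is a weighted mean of [a] and [b], these cannot lie strictly on the same side of it; on
   opposite sides the step function takes both values 0 and 1. *)
have es : (1 - u) * (a - s) + u * (b - s) = 0 by rewrite /s; ring.
move: fa fb; rewrite /f /coord_step /=; move: a_s bs u01; rewrite !neq_lt.
clearbody s; case: (ltgtP s a) => //= sa; case: (ltgtP s b) => //= sb _ _ /andP[u0 u1].
- move: sa sb; rewrite -subr_gt0 -(subr_gt0 s) => sa sb _ _.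
  have h1 : 0 <= (1 - u) * (a - s) by apply: mulr_ge0; [rewrite subr_ge0|exact: ltW].
  have [u00|u0'] := eqVneq u 0; first by move: es; rewrite u00 => es; lra.

  have {u0 u0'}u0 : 0 < u by rewrite lt_neqAle eq_sym u0' u0.
  by have := mulr_gt0 u0 sb; lra.
- by move=> <- /eqP; rewrite eq_sym oner_eq0.
- by move=> <- /eqP; rewrite oner_eq0.
- move: sa sb; rewrite -subr_gt0 -(subr_gt0 b) => sa sb _ _.
  have h1 : 0 <= (1 - u) * (s - a) by apply: mulr_ge0; [rewrite subr_ge0|exact: ltW].
  have [u00|u0'] := eqVneq u 0; first by move: es; rewrite u00 => es; lra.
  have {u0 u0'}u0 : 0 < u by rewrite lt_neqAle eq_sym u0' u0.
  by have := mulr_gt0 u0 sb; lra.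
Qed.

End FibreConvex.

(** * The linear covering attached to a closed form *)

Section LinearCovering.
Variables (R : realType) (E : diffiety R) (i0 : coordT E).
Local Notation psi := (inr ord0 : tot_coord E 1).

(** On the fibre coordinate psi the mixed derivatives are (Dx b + a b) psi and (Dy a + a b) psi, so
    they agree because the form is closed. *)
Lemma covering_of_closed (a b : pt R (coordT E) -> R) :
  (forall i, smooth (locus E) (Dx E i)) ->
  (forall i, smooth (locus E) (Dy E i)) ->
  (forall i p, locus E p -> vact (Dx E) (Dy E i) p = vact (Dy E) (Dx E i) p) ->
  closed_form (a, b) ->
  is_covering setT (fun=> fun q : pt R (tot_coord E 1) => a (proj_base q) * q psi)
                   (fun=> fun q => b (proj_base q) * q psi).
Proof.
move=> sDx sDy cD [/= sa sb cab].
set XI := fun q => a _ * _; set YI := fun q => b _ * _.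
pose L := locus (total_space setT (fun=> XI) (fun=> YI)).
have pa : smooth L (a \o @proj_base R E 1) by apply: (smooth_proj i0 _ sa) => q [].
have pb : smooth L (b \o @proj_base R E 1) by apply: (smooth_proj i0 _ sb) => q [].
have spsi : smooth L (fun q => q psi) by exact: smooth_coord.
have sX : smooth L XI by exact: smoothM.
have sY : smooth L YI by exact: smoothM.
split=> //; first exact: openT.
  by exists (fun=> 0).
apply: (commuting_total_space i0 sDx sDy sX sY) => -[i|j] q Lq; have [Eq _] := Lq.
  by rewrite (vact_proj i0 _ _ (sDy i) Eq) (vact_proj i0 _ _ (sDx i) Eq) cD.
rewrite /= (vactM _ pb spsi Lq) (vactM _ pa spsi Lq) !vact_coord.
rewrite (vact_proj i0 _ _ sb Eq) (vact_proj i0 _ _ sa Eq) /= cab// /XI /YI; ring.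
Qed.

End LinearCovering.

Lemma smooth_total_x (R : realType) (S : set (pt R jcoord)) c : smooth S (total_x c).
Proof. by case: c => [||i j]; [exact: smooth_cst|exact: smooth_cst|exact: smooth_coord]. Qed.

Lemma smooth_total_y (R : realType) (S : set (pt R jcoord)) c : smooth S (total_y c).
Proof. by case: c => [||i j]; [exact: smooth_cst|exact: smooth_cst|exact: smooth_coord]. Qed.

Theorem proposition1 (R : realType) (k r : nat)
    (U : set (pt R jcoord)) (F : 'I_r -> pt R jcoord -> R)
    (hE : is_equation k U F)
    (hconn : diff_connected (prolongation U F))
    (W : set (pt R 'I_1))
    (X Y : pt R (tot_coord (prolongation U F) 1) -> R)
    (hcov : is_covering W (fun=> X) (fun=> Y))
    (hnonabelian : ~ abelian_covering W (fun=> X) (fun=> Y))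
    (hirr : irreducible_covering W (fun=> X) (fun=> Y)) :
  let Et := total_space W (fun=> X) (fun=> Y) in
  let w : coordT Et := inr ord0 in
  let Xw := pderiv w X in
  let Yw := pderiv w Y in
  let psi : tot_coord Et 1 := inr ord0 in
  let XI := fun q => Xw (proj_base q) * q psi in
  let YI := fun q => Yw (proj_base q) * q psi in
  let EtI := total_space setT (fun=> XI) (fun=> YI) in
  let omega : hform Et := (Xw, Yw) in
  [/\ is_covering setT (fun=> XI) (fun=> YI),
      (forall q, locus EtI q -> 0 < q psi ->
        vact (Dx EtI) (fun q' => ln (q' psi)) q = Xw (proj_base q) /\
        vact (Dy EtI) (fun q' => ln (q' psi)) q = Yw (proj_base q))
    & nontrivial_claw omega].
Proof.
move=> Et w Xw Yw psi XI YI EtI omega.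
have [_ [_ _ [p0 Ep0] _ _]] := hE.
(* Any point of the nonempty fibre [W] can serve as the origin w0 of the integral. *)
have [oW [v0 Wv0] /(_ ord0) sX /(_ ord0) sY comm] := hcov.
have Ww0 : W (fun=> v0 ord0).
  by congr W: Wv0; apply/funext => j; rewrite (ord1 j).
pose i0 : coordT (prolongation U F) := jx.
have sDx i : smooth (locus (prolongation U F)) (Dx (prolongation U F) i).
  exact: smooth_total_x.
have sDy i : smooth (locus (prolongation U F)) (Dy (prolongation U F) i).
  exact: smooth_total_y.
have closed : closed_form omega.
  exact: (closed_fibre_derivative i0 sDx sDy oW sX sY comm).
split.
(* The base is now the covering [Et], and its coordinate [w] plays the part of the arbitrary base
   coordinate [i0]. *)
- apply: (covering_of_closed w) closed.
  + by move=> c; exact: (smooth_lift i0 c sDx sX).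
  + by move=> c; exact: (smooth_lift i0 c sDy sY).
  + by move=> c q; exact: commuting_coord.
- by move=> q _ q0; split; [exact: (vact_ln _ Xw)|exact: (vact_ln _ Yw)].
- split=> // ex; apply: hnonabelian.
  have cvx := fibre_convex Ep0 hirr.
  exact: (abelian_of_exact i0 sDx sDy oW sX sY comm Ep0 Ww0 cvx hirr ex).
Qed.
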